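(* Let $X$ be a real-valued random variable with distribution function $F(x)=\mathbb{P}(X\le x)$, $-\infty<x<\infty$, and let $\{X_n;\ n\ge 1\}$ be a sequence of i.i.d. random variables with common distribution function $F$. Let $$\theta=\sup\{r\ge0:\ \mathbb{E}|X|^r<\infty\}\in[0,\infty],\qquad \hat\theta_n=\frac{\log n}{\log\max_{1\le k\le n}|X_k|},\quad n\ge1.$$ Then: **(i)** Almost surely, $$\liminf_{n\to\infty}\hat\theta_n=\theta\qquad\text{and}\qquad\limsup_{n\to\infty}\hat\theta_n=\sup\left\{r\ge0:\ \liminf_{x\to\infty}x^r\,\mathbb{P}(|X|>x)=0\right\},$$ and the following three statements are equivalent: (a) $\lim_{n\to\infty}\hat\theta_n=\theta$ almost surely; (b) $\hat\theta_n\to\theta$ in probability; (c) $\lim_{x\to\infty}x^r\,\mathbb{P}(|X|>x)=\infty$ for all $r>\theta$ if $\theta<\infty$. If $0\le\theta<\infty$, then any one of (a)-(c) holds if and only if there exists a function $L:(0,\infty)\to(0,\infty)$ such that $$\mathbb{P}(|X|>x)\sim\frac{L(x)}{x^\theta}\ \text{ as }x\to\infty\qquad\text{and}\qquad\lim_{x\to\infty}\frac{\ln L(x)}{\ln x}=0.$$ **(ii)** If $\hat\theta_n\to\theta$ in probability and $0<\theta<\infty$, then $$\lim_{n\to\infty}\frac{\ln\mathbb{P}(\hat\theta_n\le\theta-s)}{\ln n}=-\frac{s}{\theta-s}\quad\text{for all }0<s<\theta$$ and $$\lim_{n\to\infty}\frac{\log\left(-\ln\mathbb{P}(\hat\theta_n\ge\theta+t)\right)}{\ln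 n}=\frac{t}{\theta+t}\quad\text{for all }t>0,$$ and hence $$\lim_{n\to\infty}\frac{\ln\mathbb{P}\left(|\hat\theta_n-\theta|\ge\epsilon\right)}{\ln n}=-\frac{\epsilon}{\theta-\epsilon}\quad\text{for all }0<\epsilon<\theta.$$ **(iii)** Suppose that there exist constants $0<\theta<\infty$ and $-\infty<\tau<\infty$ and a monotone function $h:[0,\infty)\to(0,\infty)$ with $\lim_{x\to\infty}h(x^2)/h(x)=1$ such that $$\mathbb{P}(|X|>x)\sim\frac{(\log x)^\tau h(x)}{x^\theta}\quad\text{as }x\to\infty.$$ Then, for all $-\infty<x<\infty$, $$\lim_{n\to\infty}\mathbb{P}\left(\hat\theta_n-\theta\le\frac{-\theta\tau\ln\ln n-\theta\ln h(n)+\theta\tau\ln\theta+\theta x}{\ln n}\right)=1-\exp\left(-e^{x}\right).$$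
   Context: Convention: $\log x=\ln(e\vee x)=\ln\max(e,x)$ for all $-\infty<x<\infty$, where $\ln$ is the natural logarithm (so $\log x\ge1$ always and $\hat\theta_n$ is well defined). When $\theta=\infty$, condition (c) in part (i) is vacuous, and convergence $\hat\theta_n\to\infty$ in probability means $\mathbb{P}(\hat\theta_n>M)\to1$ for every $M<\infty$. The notation $f(x)\sim g(x)$ means $f(x)/g(x)\to1$. The constant $\theta$ in part (iii) necessarily coincides with $\sup\{r\ge0:\mathbb{E}|X|^r<\infty\}$. *)

(* Defs.v *)
From mathcomp Require Export all_boot all_order all_algebra.
From mathcomp Require Export all_classical all_reals all_analysis.
Export Order.TTheory GRing.Theory Num.Theory.
Export numFieldNormedType.Exports.

Set Implicit Arguments.
Unset Strict Implicit.
Unset Printing Implicit Defensive.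

Local Open Scope classical_set_scope.
Local Open Scope ring_scope.

(* The truncated logarithm ln (max(e, x)), at least 1 everywhere; [ln] remains
   the natural logarithm. *)
Definition log {R : realType} (x : R) : R := ln (Num.max (expR 1) x).

Definition asym_equiv {R : realType} (f g : R -> R) : Prop :=
  f x / g x @[x --> +oo] --> (1 : R).

Definition Pr d (T : measurableType d) (R : realType) (P : probability T R)
  (A : set T) : R := fine (P A).

Definition mutually_independent d (T : measurableType d) (R : realType)
    (P : probability T R) (Y : nat -> {RV P >-> R}) : Prop :=
  forall (J : seq nat) (B : nat -> set R), uniq J ->
    (forall j, measurable (B j)) ->
    P (\bigcap_(j in [set` J]) (Y j @^-1` B j)) =
    (\prod_(j <- J) P (Y j @^-1` B j))%E.

Definition iid_copies d d' (T : measurableType d) (T' : measurableType d')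
    (R : realType) (P : probability T R) (Q : probability T' R)
    (X : {RV P >-> R}) (Y : nat -> {RV Q >-> R}) : Prop :=
  mutually_independent Y /\ forall n x, cdf (Y n) x = cdf X x.

Definition tail d (T : measurableType d) (R : realType) (P : probability T R)
    (X : {RV P >-> R}) (x : R) : R :=
  Pr P [set w | x < `|X w|].

Definition theta d (T : measurableType d) (R : realType) (P : probability T R)
    (X : {RV P >-> R}) : \bar R :=
  ereal_sup [set r%:E | r in
    [set r : R | 0 <= r /\ ('E_P[(fun w => (`|X w| `^ r)%R)] < +oo)%E]].

Definition theta_upper d (T : measurableType d) (R : realType)
    (P : probability T R) (X : {RV P >-> R}) : \bar R :=
  ereal_sup [set r%:E | r in
    [set r : R | 0 <= r /\
       limf_einf (fun x : R => (x `^ r * tail X x)%:E) +oo%R = 0%E]].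

(* [Y k] stands for X_(k+1), so that the maximum below is over X_1, ..., X_n;
   the base value 0 is harmless since the terms are nonnegative. *)
Definition theta_hat d (T : measurableType d) (R : realType)
    (P : probability T R) (Y : nat -> {RV P >-> R}) (n : nat) (w : T) : R :=
  log (n%:R : R) / log (\big[Num.max/0]_(k < n) `|Y k w|).

Definition cvg_in_probability d (T : measurableType d) (R : realType)
    (P : probability T R) (Z : nat -> T -> R) (l : \bar R) : Prop :=
  match l with
  | r%:E => forall eps : R, 0 < eps ->
      Pr P [set w | eps < `|Z n w - r|] @[n --> \oo] --> (0 : R)
  | +oo%E => forall M : R, Pr P [set w | M < Z n w] @[n --> \oo] --> (1 : R)
  | -oo%E => forall M : R, Pr P [set w | Z n w < M] @[n --> \oo] --> (1 : R)
  end.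

(* Main.v *)
Require Import Defs.
From mathcomp Require Import measurable_realfun.
From mathcomp Require Import zify ring lra.

(** For n large and r > 0, theta_hat_n >= r holds iff max_{k <= n} |X_k| <=
    n^(1/r), an event of probability (1 - P(|X| > n^(1/r)))^n; everything is
    read off this formula.

    The lower limit is governed by Borel-Cantelli for the events |X_n| >=
    n^(1/r), whose probabilities are summable iff E|X|^r is finite.  For the
    upper limit, if x^r P(|X| > x) is small for arbitrarily large x, then so
    is 1 - P(theta_hat_n >= r) at n of order x^r, whereas a positive lower
    bound on x^u P(|X| > x) with u < r makes P(theta_hat_n >= r) decay faster
    than any power of n.  Hence (a), (b), (c) and the existence of L are all
    equivalent to [theta_upper X <= theta X], which also gives
    ln P(|X| > x) / ln x -> - theta and then the exponents of (ii).

    In (iii), g(t) = ln h(e^t) is monotone with g(2t) - g(t) -> 0, so that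
    g(ct) - g(t) -> 0 for every c > 0 and g(t) = O(ln t); this yields
    n P(|X| > y_n) -> e^x at the relevant level y_n, and the maximum obeys the
    Poisson limit (1 - q_n)^n -> exp(- lim n q_n). *)


Local Open Scope classical_set_scope.
Local Open Scope ring_scope.

Set Implicit Arguments.
Unset Strict Implicit.

(** Information on the law is always turned into a power bound with slack: the exponent r is
    replaced by a nearby s or u, and the spare power of n absorbs constants and makes series
    converge. Since |X| may have atoms, weak and strict inequalities are kept apart:
    [theta_hat >= r] is governed by P(|X| > y), but [theta_hat <= r] by P(|X| >= y). Lower bounds
    are proved for the first tail and upper bounds for the second, so that each serves both. The
    events [r <= theta_hat Y n w] are not independent in n; for the upper limit a single n with
    probability close to 1 is therefore exhibited beyond every index. In (iii) the level is n^(1/a)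
    with a = th + s / ln n, and (a - th) ln n / a = s / th - s^2 / (th a ln n). The quadratic term
    has to vanish, and this is what the logarithmic bound on g is for: it gives s = O(ln ln n),
    which slow variation of h along comparable arguments does not state by itself. *)

Lemma measurable_set_le (R : realType) (d : measure_display) (T : measurableType d)
  (f g : T -> R) : measurable_fun setT f -> measurable_fun setT g ->
  measurable [set w | f w <= g w].
Proof.
move=> mf mg; rewrite -[X in measurable X]setTI.
have /(_ I) := measurable_fun_ler mf mg measurableT (_ : measurable [set true]); exact.
Qed.

Lemma measurable_set_lt (R : realType) (d : measure_display) (T : measurableType d)
  (f g : T -> R) : measurable_fun setT f -> measurable_fun setT g ->
  measurable [set w | f w < g w].
Proof.
move=> mf mg; rewrite -[X in measurable X]setTI.
have /(_ I) := measurable_fun_ltr mf mg measurableT (_ : measurable [set true]); exact.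
Qed.

Lemma log_gt0 (R : realType) (x : R) : 0 < log x.
Proof. by rewrite /log ln_gt0// lt_max expR_gt1 ltr01. Qed.

Lemma logE (R : realType) (x : R) : 1 <= ln x -> log x = ln x.
Proof.
move=> x1; have x0 : 0 < x.
  by rewrite ltNge; apply/negP => /ln0 h; rewrite h ler10 in x1.
by rewrite /log; congr ln; apply/max_idPr; rewrite -[leRHS]lnK ?posrE// ler_expR.
Qed.

(** * Law of the maximum and of [theta_hat] *)

Section iid_maxima.
Context (R : realType)
    (d : measure_display) (T : measurableType d) (P : probability T R)
    (d' : measure_display) (T' : measurableType d') (Q : probability T' R)
    (X : {RV P >-> R}) (Y : nat -> {RV Q >-> R}).

Definition running_max (n : nat) (w : T') : R := \big[Num.max/0]_(k < n) `|Y k w|.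

(** The weak inequality is needed because [theta_hat Y n w <= r] is the complement of a strict bound
    on the maximum. *)
Definition closed_tail (x : R) : R := Pr P [set w | x <= `|X w|].

Lemma measurable_RV_preimage (B : set R) k : measurable B -> measurable (Y k @^-1` B).
Proof. by move=> mB; rewrite -[X in measurable X]setTI; exact: measurable_funPT. Qed.

(** [iid_copies] equates distribution functions only. The half-lines []x, +oo[] are stable under
    intersection and generate the Borel sets, so uniqueness of finite measures extends the equality
    to every Borel set. *)
Lemma iid_copies_distribution (n : nat) (B : set R) :
  iid_copies X Y -> measurable B -> Q (Y n @^-1` B) = P (X @^-1` B).
Proof.
move=> [_ cdfE] mB.
rewrite -[LHS]/(distribution Q (Y n) B) -[RHS]/(distribution P X B).
apply: (measure_unique (@RGenOInfty.G R) (fun k => `](- k%:R), +oo[%classic)) => //.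
- exact: RGenOInfty.measurableE.
- move=> _ _ [x ->] [y ->]; exists (Num.max x y).
  by apply/seteqP; split => z /=; rewrite !in_itv/= !andbT gt_max => /andP.
- by move=> i; exists (- i%:R).
- apply/seteqP; split => // x _; exists (Num.truncn `|x|).+1 => //=.
  rewrite in_itv/= andbT ltrNl (le_lt_trans (ler_norm _))// normrN.
  exact: truncnS_gt.
- move=> _ [x ->].
  have : ccdf (Y n) x = ccdf X x by rewrite !ccdf_1_cdf cdfE.
  exact.
- by move=> k; rewrite (le_lt_trans (probability_le1 _ _)) ?ltry.
Qed.

Lemma iid_copies_bigcap (n : nat) (B : nat -> set R) :
  iid_copies X Y -> (forall k, measurable (B k)) ->
  Pr Q (\bigcap_(k in [set` iota 0 n]) (Y k @^-1` B k)) =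
  \prod_(0 <= k < n) Pr P (X @^-1` B k).
Proof.
move=> iid mB; rewrite /Pr iid.1 ?iota_uniq// /index_iota subn0.
elim: (iota 0 n) => [|k s IH]; first by rewrite !big_nil.
rewrite !big_cons fineM ?IH; last 2 first.
- by rewrite fin_num_measure//; exact: measurable_RV_preimage.
- rewrite prode_fin_num// => j _.
  by rewrite fin_num_measure//; exact: measurable_RV_preimage.
- by rewrite (iid_copies_distribution _ iid).
Qed.

Lemma running_max_le (n : nat) (y : R) (w : T') : 0 <= y ->
  running_max n w <= y <-> (forall k, (k < n)%N -> `|Y k w| <= y).
Proof.
move=> y0; split => [/bigmax_leP[_ h] k kn|h]; first exact: (h (Ordinal kn)).
by apply/bigmax_leP; split => // i _; exact: h.
Qed.

Lemma running_max_lt (n : nat) (y : R) (w : T') : 0 < y ->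
  running_max n w < y <-> (forall k, (k < n)%N -> `|Y k w| < y).
Proof.
move=> y0; split => [/bigmax_ltP[_ h] k kn|h]; first exact: (h (Ordinal kn)).
by apply/bigmax_ltP; split => // i _; exact: h.
Qed.

Lemma running_max_bigcap_le (n : nat) (y : R) : 0 <= y ->
  [set w | running_max n w <= y] =
  \bigcap_(k in [set` iota 0 n]) (Y k @^-1` [set x : R | `|x| <= y]).
Proof.
move=> y0; apply/seteqP; split => w /=.
  by move/(running_max_le _ _ y0) => h k /=; rewrite mem_iota => kn; exact: h.
by move=> h; apply/running_max_le => // k kn; apply: (h k); rewrite /= mem_iota.
Qed.

Lemma running_max_bigcap_lt (n : nat) (y : R) : 0 < y ->
  [set w | running_max n w < y] =
  \bigcap_(k in [set` iota 0 n]) (Y k @^-1` [set x : R | `|x| < y]).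
Proof.
move=> y0; apply/seteqP; split => w /=.
  by move/(running_max_lt _ _ y0) => h k /=; rewrite mem_iota => kn; exact: h.
by move=> h; apply/running_max_lt => // k kn; apply: (h k); rewrite /= mem_iota.
Qed.


Lemma tailC (x : R) : Pr P [set w | `|X w| <= x] = 1 - tail X x.
Proof.
have mA : measurable [set w | `|X w| <= x].
  by apply: measurable_set_le => //; exact: measurableT_comp.
rewrite /tail (_ : [set w | x < `|X w|] = ~` [set w | `|X w| <= x]); last first.
  by apply/seteqP; split => w /=; rewrite ltNge => /negP.
rewrite /Pr probability_setC// fineB ?fin_num_measure//= opprB addrC subrK//.
Qed.

Lemma closed_tailC (x : R) : Pr P [set w | `|X w| < x] = 1 - closed_tail x.
Proof.
have mA : measurable [set w | `|X w| < x].
  by apply: measurable_set_lt => //; exact: measurableT_comp.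
rewrite /closed_tail (_ : [set w | x <= `|X w|] = ~` [set w | `|X w| < x]); last first.
  by apply/seteqP; split => w /=; rewrite leNgt => /negP.
rewrite /Pr probability_setC// fineB ?fin_num_measure//= opprB addrC subrK//.
Qed.

Lemma Pr_running_max_le (n : nat) (y : R) : iid_copies X Y -> 0 <= y ->
  Pr Q [set w | running_max n w <= y] = (1 - tail X y) ^+ n.
Proof.
move=> iid y0; rewrite running_max_bigcap_le// iid_copies_bigcap//; last first.
  by move=> _; apply: measurable_set_le => //; exact: measurableT_comp.
by rewrite prodr_const_nat subn0 -tailC.
Qed.

Lemma Pr_running_max_lt (n : nat) (y : R) : iid_copies X Y -> 0 < y ->
  Pr Q [set w | running_max n w < y] = (1 - closed_tail y) ^+ n.
Proof.
move=> iid y0; rewrite running_max_bigcap_lt// iid_copies_bigcap//; last first.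
  by move=> _; apply: measurable_set_lt => //; exact: measurableT_comp.
by rewrite prodr_const_nat subn0 -closed_tailC.
Qed.

(** The truncation at e sits in both logarithms. The bound 1 <= ln n removes it from the numerator;
    r <= ln n says e <= n^(1/r), so truncating the maximum does not affect its comparison with
    n^(1/r). *)
Lemma log_ratio_ge (n : nat) (r m : R) : 1 <= ln n%:R :> R -> 0 < r <= ln n%:R ->
  (r <= log n%:R / log m) = (m <= expR (ln n%:R / r)).
Proof.
move=> n1 /andP[r0 rn].
rewrite logE// ler_pdivlMr ?log_gt0// mulrC -ler_pdivlMr// -[LHS]ler_expR /log lnK; last first.
  by rewrite posrE lt_max expR_gt0.
by rewrite ge_max ler_expR ler_pdivlMr ?mul1r// rn.
Qed.

Lemma log_ratio_gt (n : nat) (r m : R) : 1 <= ln n%:R :> R -> 0 < r < ln n%:R ->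
  (r < log n%:R / log m) = (m < expR (ln n%:R / r)).
Proof.
move=> n1 /andP[r0 rn].
rewrite logE// ltr_pdivlMr ?log_gt0// mulrC -ltr_pdivlMr// -[LHS]ltr_expR /log lnK; last first.
  by rewrite posrE lt_max expR_gt0.
by rewrite gt_max ltr_expR ltr_pdivlMr ?mul1r// rn.
Qed.

Lemma measurable_running_max (n : nat) : measurable_fun setT (running_max n).
Proof.
(* Generalised over the family, because [big_ord_recl] leaves a maximum over the shifted family. *)
suff H (Z : nat -> T' -> R) : (forall k, measurable_fun setT (Z k)) ->
    measurable_fun setT (fun w => \big[Num.max/0]_(k < n) Z k w).
  apply: (H (fun k w => `|Y k w|)) => k.
  by apply: measurableT_comp.
elim: n Z => [|n IH] Z mZ.
  by under eq_fun do rewrite big_ord0; exact: measurable_cst.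
under eq_fun do rewrite big_ord_recl.
by apply: measurable_maxr => //; exact: (IH (fun k => Z k.+1)).
Qed.

Lemma Pr_theta_hat_ge (n : nat) (r : R) : iid_copies X Y ->
  1 <= ln n%:R :> R -> 0 < r <= ln n%:R ->
  Pr Q [set w | r <= theta_hat Y n w] = (1 - tail X (expR (ln n%:R / r))) ^+ n.
Proof.
move=> iid n1 rn; rewrite -Pr_running_max_le ?expR_ge0//.
by congr Pr; apply/funext => w /=; rewrite /theta_hat log_ratio_ge.
Qed.

Lemma Pr_theta_hat_lt (n : nat) (r : R) : iid_copies X Y ->
  1 <= ln n%:R :> R -> 0 < r <= ln n%:R ->
  Pr Q [set w | theta_hat Y n w < r] = 1 - (1 - tail X (expR (ln n%:R / r))) ^+ n.
Proof.
move=> iid n1 rn; rewrite -Pr_running_max_le ?expR_ge0//.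
set A := [set w | _ <= expR _].
have mA : measurable A by apply: measurable_set_le => //; exact: measurable_running_max.
have -> : [set w | theta_hat Y n w < r] = ~` A.
  apply/seteqP; split => w /=; rewrite ltNge /theta_hat log_ratio_ge//;
    by [move/negP | move=> h; apply/negP].
by rewrite /Pr probability_setC// fineB ?fin_num_measure.
Qed.

Lemma Pr_theta_hat_le (n : nat) (r : R) : iid_copies X Y ->
  1 <= ln n%:R :> R -> 0 < r < ln n%:R ->
  Pr Q [set w | theta_hat Y n w <= r] = 1 - (1 - closed_tail (expR (ln n%:R / r))) ^+ n.
Proof.
move=> iid n1 rn; rewrite -Pr_running_max_lt ?expR_gt0//.
set A := [set w | _ < expR _].
have mA : measurable A by apply: measurable_set_lt => //; exact: measurable_running_max.
have -> : [set w | theta_hat Y n w <= r] = ~` A.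
  apply/seteqP; split => w /=; rewrite leNgt /theta_hat log_ratio_gt//;
    by [move/negP | move=> h; apply/negP].
by rewrite /Pr probability_setC// fineB ?fin_num_measure.
Qed.

End iid_maxima.

(** * Borel-Cantelli arguments *)

Section almost_sure.
Context (R : realType) (d : measure_display) (T : measurableType d)
  (P : probability T R).

Lemma sum_lt_nat_indic (t n : nat) :
  (\sum_(0 <= k < n) ((k < t)%N%:R : R)) = (minn n t)%:R.
Proof.
elim: n => [|n IH]; first by rewrite big_geq// min0n.
rewrite big_nat_recr//= IH -natrD; congr (_%:R).
by rewrite /minn; case: (ltnP n t) => nt; case: (ltnP n.+1 t) => nt1; lia.
Qed.

(** Pointwise, the number of n with n+1 <= W is the integer part of W, which differs from W by less
    than 1; both bounds follow by integration. *)
Lemma expectation_tail_series (W : T -> R) : measurable_fun setT W ->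
  (forall w, 0 <= W w) ->
  (\sum_(n <oo) P [set w | (n.+1%:R <= W w)%R] <= \int[P]_w (W w)%:E)%E /\
  (\int[P]_w (W w)%:E <= 1 + \sum_(n <oo) P [set w | (n.+1%:R <= W w)%R])%E.
Proof.
move=> mW W0; pose A n := [set w | n.+1%:R <= W w].
have mA n : measurable (A n) by exact: measurable_set_le.
have sumE : (\sum_(n <oo) P (A n) = \int[P]_w \sum_(n <oo) (\1_(A n) w)%:E)%E.
  rewrite integral_nneseries//.
  - by apply: eq_eseriesr => n _; rewrite integral_indic// setIT.
  - by move=> n; apply/measurable_EFinP; exact: measurable_indic.
have partE w n : (\sum_(0 <= k < n) (\1_(A k) w)%:E =
    (minn n (Num.truncn (W w)))%:R%:E :> \bar R)%E.
  rewrite sumEFin -sum_lt_nat_indic; congr (_%:E); apply: eq_bigr => k _.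
  by rewrite indicE truncn_gt_nat; congr (_%:R); congr nat_of_bool;
    apply/idP/idP; rewrite inE.
have serE w : (\sum_(n <oo) (\1_(A n) w)%:E = (Num.truncn (W w))%:R%:E :> \bar R)%E.
  apply/eqP; rewrite eq_le; apply/andP; split.
    apply: lime_le; first by apply: is_cvg_nneseries => n _ _; rewrite lee_fin.
    by apply: nearW => n; rewrite partE lee_fin ler_nat geq_minr.
  apply: le_trans (nneseries_lim_ge (Num.truncn (W w)) _); last by move=> n _ _; rewrite lee_fin.
  by rewrite partE minnn.
have mS : measurable_fun setT (fun w => \sum_(n <oo) (\1_(A n) w)%:E : \bar R)%E.
  apply: (@ge0_emeasurable_sum _ _ _ _ (fun n w => (\1_(A n) w)%:E) xpredT).
    by move=> n w _ _; rewrite lee_fin.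
  by move=> n _; apply/measurable_EFinP; exact: measurable_indic.
rewrite sumE; split.
  apply: ge0_le_integral => //.
  - by move=> w _; rewrite serE lee_fin.
  - exact/measurable_EFinP.
  - move=> w _; rewrite serE lee_fin.
    by have /truncn_itv/andP[] := W0 w.
have -> : (1 = \int[P]_w (cst 1 w) :> \bar R)%E.
  by rewrite integral_cst// [X in (_ * X)%E]probability_setT mule1.
rewrite -ge0_integralD//; last by move=> w _; rewrite serE lee_fin.
apply: ge0_le_integral => //.
- by move=> w _; rewrite lee_fin.
- exact/measurable_EFinP.
- by apply: emeasurable_funD.
- move=> w _; rewrite serE/= lee_fin.
  by have /truncn_itv/andP[_ /ltW] := W0 w; rewrite -natr1 addrC.
Qed.

Lemma ae_eventually_not (A : nat -> set T) : (forall k, measurable (A k)) ->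
  (\sum_(k <oo) P (A k) < +oo)%E ->
  {ae P, forall w, \forall k \near \oo, ~ A k w}.
Proof.
move=> mA sA; exists (lim_sup_set A); split.
- apply: bigcap_measurable => // k _; exact: bigcup_measurable.
- exact: lim_sup_set_cvg0.
- move=> w /= h N _; apply: contrapT => hN; apply: h; exists N => // k /= Nk Ak.
  by apply: hN; exists k.
Qed.

(** Plays the role of the second Borel-Cantelli lemma without mentioning independence: each union
    over k >= N has measure 1 once measurable subsets of it have measure arbitrarily close to 1. *)
Lemma ae_infinitely_often (A : nat -> set T) : (forall k, measurable (A k)) ->
  (forall N (e : R), 0 < e -> exists B, [/\ measurable B,
    B `<=` \bigcup_(k in [set k | (N <= k)%N]) A k & 1 - e <= Pr P B]) ->
  {ae P, forall w, forall N, exists2 k, (N <= k)%N & A k w}.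
Proof.
move=> mA hA; apply: ae_foralln => N.
have mU : measurable (\bigcup_(k in [set k | (N <= k)%N]) A k).
  exact: bigcup_measurable.
exists (~` \bigcup_(k in [set k | (N <= k)%N]) A k); split.
- exact: measurableC.
- rewrite [LHS]probability_setC//; apply/eqP; rewrite -(@fineK _ (P _)) ?fin_num_measure//.
  rewrite -EFinB eqe subr_eq0 eq_sym eq_le; apply/andP; split.
    by rewrite -lee_fin fineK ?fin_num_measure//; exact: probability_le1.
  apply/ler_addgt0Pr => e /(hA N)[] B [mB BU]; rewrite lerBlDr => /le_trans; apply.
  rewrite lerD2r fine_le ?fin_num_measure//.
  by apply: le_measure => //; rewrite inE.
- move=> w /= h [k /= Nk Ak]; apply: h; exists k => //.
Qed.

End almost_sure.

(** * Tails and moments *)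

Lemma near_ln_ge (R : realType) (a : R) : \forall n \near \oo, a <= ln (n%:R : R).
Proof.
near=> n; have : expR a <= n%:R by near: n; exact: nbhs_infty_ger.
move=> an; rewrite -[leLHS]expRK ler_ln ?posrE ?expR_gt0//.
exact: lt_le_trans (expR_gt0 _) an.
Unshelve. all: by end_near. Qed.

Lemma bernoulli_le (R : realType) (p : R) (n : nat) : 0 <= p <= 1 ->
  1 - n%:R * p <= (1 - p) ^+ n.
Proof.
move=> /andP[p0 p1]; elim: n => [|n IH]; first by rewrite expr0 mul0r subr0.
rewrite exprS; apply: le_trans (ler_wpM2l _ IH); last by rewrite subr_ge0.
rewrite -natr1; have : 0 <= n%:R * p * p :> R by rewrite !mulr_ge0.
lra.
Qed.

Lemma expr_le_expR (R : realType) (p : R) (n : nat) : p <= 1 ->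
  (1 - p) ^+ n <= expR (- (n%:R * p)).
Proof.
move=> p1; rewrite -mulrN mulrC expRM_natr.
by apply: lerXn2r; rewrite ?nnegrE ?subr_ge0 ?expR_ge0// expR_ge1Dx.
Qed.

Lemma nneseries_le_bound (R : realType) (f : nat -> \bar R) (m : \bar R) :
  (forall n, 0 <= f n)%E -> (forall n, \sum_(0 <= k < n) f k <= m)%E ->
  (\sum_(n <oo) f n <= m)%E.
Proof.
move=> f0 fm; apply: lime_le; first exact: is_cvg_nneseries.
exact: nearW.
Qed.

Section tails.
Context (R : realType) (d : measure_display) (T : measurableType d)
  (P : probability T R) (X : {RV P >-> R}).

Lemma measurable_norm_RV : measurable_fun setT (fun w => `|X w|).
Proof. exact: measurableT_comp. Qed.

Lemma Pr_ge0 (A : set T) : 0 <= Pr P A.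
Proof. exact: fine_ge0. Qed.

Lemma Pr_le1 (A : set T) : measurable A -> Pr P A <= 1.
Proof.
move=> mA; rewrite -lee_fin fineK ?fin_num_measure//; exact: probability_le1.
Qed.

Lemma le_Pr (A B : set T) : measurable A -> measurable B -> A `<=` B ->
  Pr P A <= Pr P B.
Proof.
by move=> mA mB AB; rewrite fine_le ?fin_num_measure// le_measure// inE.
Qed.

Lemma measurable_tail (x : R) : measurable [set w | x < `|X w|].
Proof. by apply: measurable_set_lt => //; exact: measurable_norm_RV. Qed.

Lemma measurable_closed_tail (x : R) : measurable [set w | x <= `|X w|].
Proof. by apply: measurable_set_le => //; exact: measurable_norm_RV. Qed.

Lemma tail_itv (x : R) : 0 <= tail X x <= 1.
Proof. by rewrite Pr_ge0 Pr_le1//; exact: measurable_tail. Qed.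

Lemma closed_tail_itv (x : R) : 0 <= closed_tail X x <= 1.
Proof. by rewrite Pr_ge0 Pr_le1//; exact: measurable_closed_tail. Qed.

Lemma tail_le_closed_tail (x : R) : tail X x <= closed_tail X x.
Proof.
apply: le_Pr; [exact: measurable_tail|exact: measurable_closed_tail|].
by move=> w /= /ltW.
Qed.

Lemma tail_nincr (x y : R) : x <= y -> tail X y <= tail X x.
Proof.
move=> xy; apply: le_Pr; [exact: measurable_tail|exact: measurable_tail|].
by move=> w /=; exact: le_lt_trans.
Qed.

Lemma cvg_tail0 : tail X x @[x --> +oo] --> 0.
Proof.
have mN : measurable_fun setT (fun w => `|X w|) := measurable_norm_RV.
(* |X| is packaged as a random variable so that the limit of distribution functions at infinity
   applies to it. *)
pose N := mfun_Sub (mem_set mN : (fun w => `|X w|) \in mfun).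
have NE : (fun x => 1 - fine (cdf (N : {RV P >-> R}) x)) = tail X.
  apply/funext => x; rewrite -[LHS]/(1 - Pr P ((fun w => `|X w|) @^-1` `]-oo, x])).
  rewrite (_ : _ @^-1` _ = [set w | `|X w| <= x]); first by rewrite tailC; lra.
  by apply/seteqP; split => w /=; rewrite in_itv.
rewrite -NE -(subrr (1 : R)).
by apply: cvgB; [exact: cvg_cst|apply: fine_cvg; exact: cvg_cdfy1].
Qed.

Lemma markov_closed_tail (r : R) : 0 <= r ->
  ('E_P[(fun w => (`|X w| `^ r)%R)] < +oo)%E ->
  exists2 C, 0 < C & forall x, 0 < x -> closed_tail X x <= C * x `^ (- r).
Proof.
move=> r0 Er; set E := 'E_P[_]%E in Er.
have E0 : (0 <= E)%E.
  by rewrite /E unlock; apply: integral_ge0 => w _; rewrite lee_fin powR_ge0.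
have Efin : E \is a fin_num by rewrite ge0_fin_numE.
exists (fine E + 1); first by rewrite ltr_wpDl// fine_ge0.
move=> x x0; rewrite powRN ler_pdivlMr ?powR_gt0// mulrC.
suff : x `^ r * closed_tail X x <= fine E by move/le_trans; apply; rewrite lerDl.
rewrite -lee_fin fineK// EFinM fineK; last first.
  by rewrite fin_num_measure//; exact: measurable_closed_tail.
have := @markov _ _ _ P X (@powR R ^~ r) x x0 (measurable_powR r)
  (fun _ _ => powR_ge0 _ _).
apply.
by move=> u v u0 v0 uv; apply: ge0_ler_powR.
Qed.

Lemma theta_ge0 : (0 <= theta X)%E.
Proof.
apply: ereal_sup_ubound; exists 0 => //=; split => //.
under [X in 'E_P[X]%E]eq_fun do rewrite powRr0.
by rewrite expectation_cst ltry.
Qed.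

Lemma lt_theta (r : R) : (r%:E < theta X)%E -> exists s,
  [/\ r < s, 0 <= s & ('E_P[(fun w => (`|X w| `^ s)%R)] < +oo)%E].
Proof. by move=> /ereal_sup_gt[_ [s [s0 Es] <-]]; rewrite lte_fin => rs; exists s. Qed.

Lemma theta_lt (r : R) : (theta X < r%:E)%E ->
  0 < r /\ 'E_P[(fun w => (`|X w| `^ r)%R)]%E = +oo%E.
Proof.
move=> tr; have r0 : 0 < r by rewrite -lte_fin (le_lt_trans theta_ge0).
split => //; apply/eqP; rewrite -leye_eq leNgt; apply/negP => Er.
suff /(lt_le_trans tr) : (r%:E <= theta X)%E by rewrite ltxx.
by apply: ereal_sup_ubound; exists r => //=; split => //; exact: ltW.
Qed.

Lemma closed_tail_bound (r : R) : (r%:E < theta X)%E ->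
  exists2 C, 0 < C & forall x, 1 <= x -> closed_tail X x <= C * x `^ (- r).
Proof.
move=> /lt_theta[s [rs s0 Es]]; have [C C0 CX] := markov_closed_tail s0 Es.
exists C => // x x1; apply: le_trans (CX _ _) _; first exact: lt_le_trans x1.
by rewrite ler_wpM2l ?(ltW C0)// ler_powR// lerN2 ltW.
Qed.

End tails.

Lemma limf_einf_pinfty_eq0 (R : realType) (f : R -> R) : (forall x, 0 <= f x) ->
  limf_einf (fun x => (f x)%:E) +oo%R = 0%E <->
  (forall e x0, 0 < e -> exists2 x, x0 < x & f x < e).
Proof.
move=> f0; rewrite limf_einfE; split.
- move=> supE e x0 e0; apply: contrapT => h.
  have : (e%:E <= 0 :> \bar R)%E.
    rewrite -supE; apply: ereal_sup_ge; exists (ereal_inf [set (f x)%:E | x in [set x | x0 < x]]).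
      by exists [set x | x0 < x] => //; apply: nbhs_pinfty_gt; exact: num_real.
    apply: le_ereal_inf_tmp => _ [x /= x0x <-]; rewrite lee_fin leNgt.
    by apply/negP => fx; apply: h; exists x.
  by rewrite lee_fin leNgt e0.
- move=> h; apply/eqP; rewrite eq_le; apply/andP; split.
    apply: ge_ereal_sup => _ [V [x0 [_ Vx0]] <-]; apply/lee_addgt0Pr => e e0.
    have [x x0x fx] := h e x0 e0; rewrite add0e.
    apply: le_trans (_ : (f x)%:E <= _)%E; last by rewrite lee_fin ltW.
    by apply: ereal_inf_lbound; exists x => //; exact: Vx0.
  apply: ereal_sup_ge; exists (ereal_inf [set (f x)%:E | x in setT]).
    by exists setT => //; exact: filterT.
  by apply: le_ereal_inf_tmp => _ [x _ <-]; rewrite lee_fin.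
Qed.

Section theta_upper_facts.
Context (R : realType) (d : measure_display) (T : measurableType d)
  (P : probability T R) (X : {RV P >-> R}).

Let powR_tail_ge0 (r x : R) : 0 <= x `^ r * tail X x.
Proof. by rewrite mulr_ge0 ?powR_ge0//; case/andP: (tail_itv X x). Qed.

Lemma theta_upper_ge0 : (0 <= theta_upper X)%E.
Proof.
apply: ereal_sup_ubound; exists 0 => //=; split => //.
apply/limf_einf_pinfty_eq0 => // e x0 e0.
have /cvgrPdist_lt/(_ _ e0)[y [_ hy]] := @cvg_tail0 _ _ _ _ X.
exists (Num.max x0 y + 1); first by rewrite ltr_pwDr// le_max lexx.
rewrite powRr0 mul1r; have : `|0 - tail X (Num.max x0 y + 1)| < e.
  by apply: hy; rewrite ltr_pwDr// le_max lexx orbT.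
by rewrite sub0r normrN ger0_norm//; case/andP: (tail_itv X (Num.max x0 y + 1)).
Qed.

(** The supremum only provides some admissible s > r; searching among x > 1 gives x^r <= x^s, which
    passes the smallness down to r. *)
Lemma lt_theta_upper (r e x0 : R) : (r%:E < theta_upper X)%E -> 0 < e ->
  exists2 x, x0 < x & x `^ r * tail X x < e.
Proof.
move=> /ereal_sup_gt[_ [s [s0]]] /limf_einf_pinfty_eq0/(_ e (Num.max 1 x0)) h <-.
rewrite lte_fin => rs e0; have [//|x] := h _ e0.
rewrite gt_max => /andP[x1 x0x] xe; exists x => //; apply: le_lt_trans xe.
rewrite ler_wpM2r//; first by case/andP: (tail_itv X x).
by rewrite ler_powR ?ltW.
Qed.

Lemma theta_upper_lt (r : R) : (theta_upper X < r%:E)%E ->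
  exists c x0, 0 < c /\ forall x, x0 < x -> c <= x `^ r * tail X x.
Proof.
move=> tr; have r0 : 0 < r by rewrite -lte_fin (le_lt_trans theta_upper_ge0).
apply: contrapT => h.
suff /(lt_le_trans tr) : (r%:E <= theta_upper X)%E by rewrite ltxx.
apply: ereal_sup_ubound; exists r => //=; split; first exact: ltW.
apply/limf_einf_pinfty_eq0 => // e x0 e0; apply: contrapT => hx.
apply: h; exists e, x0; split => // x x0x; rewrite leNgt; apply/negP => xe.
by apply: hx; exists x.
Qed.

Lemma theta_upper_le (r c x0 : R) : 0 < c ->
  (forall x, x0 < x -> c <= x `^ r * tail X x) -> (theta_upper X <= r%:E)%E.
Proof.
move=> c0 h; rewrite leNgt; apply/negP => /(@lt_theta_upper _ _ x0)/(_ c0)[x x0x].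
by rewrite ltNge h.
Qed.

End theta_upper_facts.

(** * The almost sure lower limit *)

Section theta_hat_limits.
Context (R : realType)
    (d : measure_display) (T : measurableType d) (P : probability T R)
    (d' : measure_display) (T' : measurableType d') (Q : probability T' R)
    (X : {RV P >-> R}) (Y : nat -> {RV Q >-> R}) (iidY : iid_copies X Y).

Lemma theta_hat_gt0 n w : 0 < theta_hat Y n w.
Proof. by rewrite divr_gt0// log_gt0. Qed.

Lemma measurable_theta_hat n : measurable_fun setT (theta_hat Y n).
Proof.
(* The reciprocal is rewritten as the power -1, whose measurability is that of [powR]; the two agree
   because the logarithm is positive. *)
rewrite (_ : theta_hat Y n = fun w =>
    log n%:R * (ln (Num.max (expR 1) (running_max Y n w))) `^ (-1)).
  apply: measurable_funM => //; apply: (measurableT_comp (measurable_powR _)) => //.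
  apply: (measurableT_comp (@measurable_ln R)) => //.
  by apply: measurable_maxr => //; exact: measurable_running_max.
by apply/funext => w; rewrite powR_inv1// ltW// -/(log _) log_gt0.
Qed.

Lemma measurable_theta_hat_ge n (r : R) : measurable [set w | r <= theta_hat Y n w].
Proof. by apply: measurable_set_le => //; exact: measurable_theta_hat. Qed.

Lemma measurable_theta_hat_gt n (r : R) : measurable [set w | r < theta_hat Y n w].
Proof. by apply: measurable_set_lt => //; exact: measurable_theta_hat. Qed.

Lemma measurable_theta_hat_le n (r : R) : measurable [set w | theta_hat Y n w <= r].
Proof. by apply: measurable_set_le => //; exact: measurable_theta_hat. Qed.

Lemma measurable_theta_hat_lt n (r : R) : measurable [set w | theta_hat Y n w < r].
Proof. by apply: measurable_set_lt => //; exact: measurable_theta_hat. Qed.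

Lemma measurable_powR_norm_ge (a r : R) : measurable [set x : R | a <= `|x| `^ r].
Proof.
apply: measurable_set_le => //; apply: (measurableT_comp (measurable_powR _)).
exact: normr_measurable.
Qed.

(** Borel-Cantelli is applied to single variables, not to maxima: some s > r has a finite moment, so
    |X_k|^s < k for all k past a random index. The finitely many earlier terms are fixed, and
    n^(1/r) overtakes them. *)
Lemma theta_hat_eventually_ge (r : R) : (r%:E < theta X)%E ->
  {ae Q, forall w, \forall n \near \oo, r <= theta_hat Y n w}.
Proof.
have [r0 _|r0 rt] := leP r 0.
  by apply: aeW => w; apply: nearW => n; rewrite (le_trans r0)// ltW// theta_hat_gt0.
have [s [rs s0 Es]] := lt_theta rt.
pose A k := Y k @^-1` [set x : R | k.+1%:R <= `|x| `^ s].
have mA k : measurable (A k).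
  by apply: measurable_RV_preimage; exact: measurable_powR_norm_ge.
have sA : (\sum_(k <oo) Q (A k) < +oo)%E.
  rewrite (eq_eseriesr (g := fun k => P [set w | (k.+1%:R <= `|X w| `^ s)%R])); last first.
    by move=> k _; rewrite (iid_copies_distribution _ iidY)//; exact: measurable_powR_norm_ge.
  apply: le_lt_trans Es; rewrite expectation.unlock.
  have mXs : measurable_fun setT (fun w => `|X w| `^ s).
    by apply: (measurableT_comp (measurable_powR _)); exact: measurable_norm_RV.
  by have [+ _] := expectation_tail_series P mXs (fun _ => powR_ge0 _ _).
apply: filterS (ae_eventually_not mA sA) => w [N _ hN].
near=> n.
have ln1 : 1 <= ln (n%:R : R) by near: n; exact: near_ln_ge.
have lnr : r <= ln (n%:R : R) by near: n; exact: near_ln_ge.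
(* n^(1/r) exceeds the maximum of the first N terms, N being the random index past which no [A k]
   occurs; the 1 keeps the argument of [ln] positive. *)
have lnM : r * ln (Num.max 1 (running_max Y N w)) <= ln (n%:R : R).
  by near: n; exact: near_ln_ge.
rewrite /theta_hat log_ratio_ge ?r0//.
have n0 : 0 < n%:R :> R by rewrite ltNge; apply/negP => /ln0 h; rewrite h ler10 in ln1.
apply/running_max_le; first exact: expR_ge0.
move=> k kn; have [Nk|kN] := leqP N k; last first.
  have M0 : 0 < Num.max 1 (running_max Y N w) by rewrite lt_max ltr01.
  have [Yk _] := running_max_le Y N w (ltW M0).
  apply: le_trans (Yk _ _ kN) _; first by rewrite le_max lexx orbT.
  by rewrite -[leLHS]lnK ?posrE// ler_expR ler_pdivlMr// mulrC.
have [Y1|Y1] := leP `|Y k w| 1.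
  by apply: le_trans Y1 _; rewrite -[leLHS]expR0 ler_expR divr_ge0 ?ltW// (lt_le_trans r0).
have Y0 : 0 < `|Y k w| := lt_trans ltr01 Y1.
rewrite -[leLHS]lnK ?posrE// ler_expR ler_pdivlMr// mulrC -ln_powR.
rewrite ler_ln ?posrE ?powR_gt0//.
apply: le_trans (_ : `|Y k w| `^ s <= _); first by rewrite ler_powR// ltW.
have := hN k Nk; rewrite /A/= => /negP; rewrite -ltNge => /ltW/le_trans; apply.
by rewrite ler_nat.
Unshelve. all: by end_near. Qed.

(** An infinite moment of order r makes the series of P(|X|^r >= k) diverge, and independence bounds
    the probability that none of the events between N and n occurs by a product of factors 1 - p <=
    exp(-p). *)
Lemma theta_hat_often_le (r : R) : (theta X < r%:E)%E ->
  {ae Q, forall w, forall N, exists2 n, (N <= n)%N & theta_hat Y n w <= r}.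
Proof.
move=> /theta_lt[r0 Er].
pose B k := [set x : R | k.+1%:R <= `|x| `^ r].
have mB k : measurable (B k) by exact: measurable_powR_norm_ge.
pose A k := Y k @^-1` B k.
have mA k : measurable (A k) by exact: measurable_RV_preimage.
pose p k := Pr P (X @^-1` B k).
have mXB k : measurable (X @^-1` B k).
  by rewrite -[X in measurable X]setTI; exact: measurable_funPT.
have p_unbounded (M : R) : exists n, M < \sum_(0 <= k < n) p k.
  apply: contrapT => h.
  have mXr : measurable_fun setT (fun w => `|X w| `^ r).
    by apply: (measurableT_comp (measurable_powR _)); exact: measurable_norm_RV.
  have [_] := expectation_tail_series P mXr (fun _ => powR_ge0 _ _).
  move: Er; rewrite expectation.unlock => ->; apply/negP; rewrite -ltNge.
  apply: le_lt_trans (_ : (1 + M)%:E < _)%E; last by rewrite ltry.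
  rewrite EFinD leeD2l//; apply: nneseries_le_bound => // n.
  rewrite (eq_bigr (fun k => (p k)%:E)).
    by rewrite sumEFin lee_fin leNgt; apply/negP => Mn; apply: h; exists n.
  by move=> k _; rewrite /p fineK// fin_num_measure.
have : {ae Q, forall w, forall N, exists2 k, (N <= k)%N & A k w}.
  apply: ae_infinitely_often => // N e e0.
  (* The first N indices are left unconstrained and cost at most a factor exp(N); the choice N - ln
     e leaves exactly e. *)
  have [n hn] := p_unbounded (N%:R - ln e).
  pose C k := if (k < N)%N then setT else ~` B k.
  have mC k : measurable (C k) by rewrite /C; case: ifP => // _; exact: measurableC.
  set D := \bigcap_(k in [set` iota 0 n]) (Y k @^-1` C k).
  have mD : measurable D.
    by apply: bigcap_measurableType => k _; exact: measurable_RV_preimage.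
  exists (~` D); split; first exact: measurableC.
    move=> w hw; apply: contrapT => h; apply: hw => k /= kn; rewrite /C.
    case: ltnP => // Nk Bk; apply: h; exists k => //.
  rewrite /Pr probability_setC// fineB ?fin_num_measure//= lerD2l lerN2.
  rewrite -/(Pr Q D) (iid_copies_bigcap n iidY)//.
  (* One formula for both cases: for k < N the factor is 1 <= exp(1 - p k), otherwise 1 - p k <=
     exp(- p k). *)
  have CE k : 0 <= Pr P (X @^-1` C k) <= expR ((k < N)%N%:R - p k).
    rewrite Pr_ge0/= /C; case: ltnP => kN.
      rewrite preimage_setT /Pr probability_setT/= -[leLHS]expR0 ler_expR subr_ge0.
      exact: Pr_le1.
    have -> : X @^-1` (~` B k) = ~` (X @^-1` B k) by [].
    rewrite /Pr probability_setC// fineB ?fin_num_measure//=.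
    by rewrite sub0r expR_ge1Dx.
  have prodE := @ler_prod R nat (index_iota 0 n) xpredT _ _ (fun k _ => CE k).
  apply: le_trans prodE _.
  rewrite -expR_sum -[leRHS]lnK ?posrE// ler_expR big_split/= sumrN.
  rewrite sum_lt_nat_indic.
  have : (minn n N)%:R <= N%:R :> R by rewrite ler_nat geq_minr.
  by move: hn; set S := \sum_(_ <= _ < _) _; lra.
apply: filterS => w h N.
have [N0 _ hN0] := near_ln_ge (Num.max 1 (r + 1)).
(* [Y k] is the last of the first [k.+1] variables and |Y k|^r >= k+1, so the sample size to use is
   [k.+1]. *)
have [k Nk Ak] := h (maxn N N0); exists k.+1; first by move: Nk; lia.
have : Num.max 1 (r + 1) <= ln (k.+1%:R : R) by apply: hN0 => /=; move: Nk; lia.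
rewrite ge_max => /andP[k1 kr]; rewrite leNgt /theta_hat log_ratio_gt//; last first.
  by rewrite r0/= (lt_le_trans _ kr)// ltrDl.
apply/negP => /running_max_lt-/(_ (expR_gt0 _))/(_ k (ltnSn k)).
move: Ak; rewrite /A/B/= => Ak; apply/negP; rewrite -leNgt.
have Y0 : 0 < `|Y k w|.
  rewrite lt_neqAle normr_ge0 andbT eq_sym; apply/eqP => Y0.
  by move: Ak; rewrite Y0 powR0 ?gt_eqF// leNgt ltr0n.
rewrite -[leRHS]lnK ?posrE// ler_expR ler_pdivrMr// mulrC -ln_powR.
by rewrite ler_ln ?posrE ?powR_gt0.
Qed.

End theta_hat_limits.

(** Passes from a real level x to a sample size n with n^(1/r) >= x: n is the integer part of x^r
    plus 1, and x^r >= 1 accounts for the factor 2. *)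
Lemma nat_powR_approx (R : realType) (x r : R) : 1 <= x -> 0 < r ->
  exists n : nat, [/\ x `^ r <= n%:R, n%:R <= 2 * x `^ r & x <= expR (ln n%:R / r)].
Proof.
move=> x1 r0; have x0 : 0 < x := lt_le_trans ltr01 x1.
have xr1 : 1 <= x `^ r by rewrite -(powRr0 x) ler_powR// ltW.
have /truncn_itv/andP[lx xl] : 0 <= x `^ r by exact: powR_ge0.
exists (Num.truncn (x `^ r)).+1; split; [exact: ltW| |].
  by rewrite -natr1; lra.
rewrite -[leLHS]lnK ?posrE// ler_expR ler_pdivlMr// mulrC -ln_powR.
by rewrite ler_ln ?posrE ?powR_gt0// ltW.
Qed.

Lemma linear_le_expR (R : realType) (k c b : R) : 0 < c -> 0 < b ->
  exists t0, forall t, t0 <= t -> k * t <= c * expR (b * t).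
Proof.
move=> c0 b0; exists (Num.max 0 (2 * k / (c * b ^+ 2))) => t.
rewrite ge_max => /andP[t0]; rewrite ler_pdivrMr ?mulr_gt0 ?exprn_gt0// => kt.
have := expR_ge1Dxn 1 (mulr_ge0 (ltW b0) t0); rewrite exprMn (_ : 2`!%:R = 2)//.
set e := expR _ => he.
apply: le_trans (_ : c * (b ^+ 2 * t ^+ 2 / 2) <= _); last first.
  by rewrite ler_wpM2l ?(ltW c0)//; lra.
have : 0 <= t * (t * (c * b ^+ 2) - 2 * k) by rewrite mulr_ge0// subr_ge0.
lra.
Qed.

(** Each term is at most the telescoping difference 1/(k+1) - 1/(k+2); the induction carries the
    sharper bound 1 - 1/(n+1). *)
Lemma sum_invn2_le1 (R : realType) (n : nat) :
  \sum_(0 <= k < n) ((k.+2%:R : R) ^+ 2)^-1 <= 1.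
Proof.
apply: le_trans (_ : 1 - (n.+1%:R)^-1 <= 1 :> R); last first.
  by rewrite gerBl invr_ge0.
elim: n => [|n IH]; first by rewrite big_geq// invr1 subrr.
rewrite big_nat_recr//=; apply: le_trans (lerD IH (lexx _)) _.
rewrite -[n.+2%:R]natr1; set a := n.+1%:R; have a0 : 0 < a :> R by rewrite ltr0n.
have aE : a^-1 - (a + 1)^-1 = (a * (a + 1))^-1.
  by field; rewrite !gt_eqF// ltr_pwDr.
have : ((a + 1) ^+ 2)^-1 <= (a * (a + 1))^-1.
  by rewrite lef_pV2 ?posrE ?mulr_gt0 ?exprn_gt0 ?addr_gt0//; nra.
rewrite -aE; move: (a^-1) ((a + 1)^-1) ((a + 1) ^- 2) => x y z; lra.
Qed.

(** * The almost sure upper limit, and one-sided convergence in probability *)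

Section theta_hat_limsup.
Context (R : realType)
    (d : measure_display) (T : measurableType d) (P : probability T R)
    (d' : measure_display) (T' : measurableType d') (Q : probability T' R)
    (X : {RV P >-> R}) (Y : nat -> {RV Q >-> R}) (iidY : iid_copies X Y).

(** Allowing any x below n^(1/r) lets x be prescribed first and n be fitted to it afterwards. *)
Lemma Pr_theta_hat_ge_lower (r x : R) (n : nat) :
  1 <= ln n%:R :> R -> 0 < r <= ln n%:R -> 0 <= x <= expR (ln n%:R / r) ->
  1 - n%:R * tail X x <= Pr Q [set w | r <= theta_hat Y n w].
Proof.
move=> n1 rn /andP[x0 xy]; rewrite (Pr_theta_hat_ge iidY)//.
apply: le_trans (bernoulli_le n (tail_itv X _)).
by rewrite lerD2l lerN2 ler_wpM2l//; exact: tail_nincr.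
Qed.

Lemma theta_hat_often_ge (r : R) : (r%:E < theta_upper X)%E ->
  {ae Q, forall w, forall N, exists2 n, (N <= n)%N & r <= theta_hat Y n w}.
Proof.
have [r0 _|r0 rt] := leP r 0.
  by apply: aeW => w N; exists N => //; rewrite (le_trans r0)// ltW// theta_hat_gt0.
apply: ae_infinitely_often => [n|N e e0]; first exact: measurable_theta_hat_ge.
have [N0 _ hN0] := near_ln_ge (Num.max 1 r).
set m := (maxn N N0).+1.
(* The half pays for n <= 2 x^r; taking x beyond m^(1/r) then forces n >= m. *)
have e20 : 0 < e / 2 by rewrite divr_gt0.
have [x] := lt_theta_upper (Num.max 1 (expR (ln m%:R / r))) rt e20.
rewrite gt_max => /andP[x1 xm xe].
have [n [nx1 nx2 nx3]] := nat_powR_approx (ltW x1) r0.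
have mn : (m <= n)%N.
  rewrite -(ler_nat R); apply: le_trans nx1.
  rewrite -[leLHS]lnK ?posrE// -[leRHS]lnK ?posrE ?powR_gt0 ?(lt_trans ltr01)//.
  rewrite ler_expR ln_powR mulrC -ler_pdivrMr// -ler_expR lnK ?posrE ?(lt_trans ltr01)//.
  exact: ltW.
have : Num.max 1 r <= ln (n%:R : R) by apply: hN0 => /=; move: mn; rewrite /m; lia.
rewrite ge_max => /andP[n1 rn].
exists [set w | r <= theta_hat Y n w]; split; first exact: measurable_theta_hat_ge.
  by move=> w /= h; exists n => //=; move: mn; rewrite /m; lia.
apply: le_trans (Pr_theta_hat_ge_lower (r := r) (x := x) n1 _ _); last 2 first.
- by rewrite r0.
- by rewrite nx3 (le_trans ler01)// ltW.
rewrite lerD2l lerN2; apply: le_trans (ler_wpM2r _ nx2) _.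
  by case/andP: (tail_itv X x).
by rewrite -mulrA; move: xe; lra.
Qed.

(** At y = n^(1/r) one has n P(|X| > y) >= c n^(1 - u/r), a positive power of n, which beats k ln n
    for every k. The value k = 2 gives a summable bound, k = 1 convergence to 0, and the two-sided
    rate in (ii) needs k above the exponent of the lower deviation. *)
Lemma theta_hat_ge_decay (u r c x0 k : R) : 0 < r -> u < r -> 0 < c ->
  (forall x, x0 < x -> c <= x `^ u * tail X x) ->
  \forall n \near \oo, Pr Q [set w | r <= theta_hat Y n w] <= expR (- (k * ln n%:R)).
Proof.
move=> r0 ur c0 hc; have b0 : 0 < 1 - u / r by rewrite subr_gt0 ltr_pdivrMr// mul1r.
have [t0 ht0] := linear_le_expR k c0 b0.
near=> n.
have n1 : 1 <= ln (n%:R : R) by near: n; exact: near_ln_ge.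
have rn : r <= ln (n%:R : R) by near: n; exact: near_ln_ge.
have tn : t0 <= ln (n%:R : R) by near: n; exact: near_ln_ge.
have xn : r * (ln (Num.max 1 x0) + 1) <= ln (n%:R : R) by near: n; exact: near_ln_ge.
have n0 : 0 < n%:R :> R by rewrite ltNge; apply/negP => /ln0 h; rewrite h ler10 in n1.
rewrite (Pr_theta_hat_ge iidY) ?r0//.
set y := expR (ln n%:R / r).
have xy : x0 < y.
  apply: le_lt_trans (_ : Num.max 1 x0 < _); first by rewrite le_max lexx orbT.
  rewrite -[ltLHS]lnK ?posrE ?lt_max ?ltr01// ltr_expR ltr_pdivlMr// mulrC.
  by apply: lt_le_trans xn; rewrite ltr_pM2l// ltrDl.
have /andP[G0 G1] := tail_itv X y.
apply: le_trans (expr_le_expR n G1) _; rewrite ler_expR lerN2.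
apply: le_trans (ht0 _ tn) _.
have := ler_wpM2l (expR_ge0 ((1 - u / r) * ln n%:R)) (hc _ xy).
rewrite mulrC {1}/y -expRM mulrA -expRD => /le_trans; apply; rewrite ler_wpM2r//.
rewrite (_ : _ + _ = ln n%:R) ?lnK ?posrE//.
by field; rewrite gt_eqF.
Unshelve. all: by end_near. Qed.

Lemma theta_hat_eventually_le (r : R) : (theta_upper X < r%:E)%E ->
  {ae Q, forall w, \forall n \near \oo, theta_hat Y n w <= r}.
Proof.
move=> tr; have r0 : 0 < r by rewrite -lte_fin (le_lt_trans (theta_upper_ge0 X)).
have [u tu ur] : exists2 u : R, (theta_upper X < u%:E)%E & u < r.
  move: tr (theta_upper_ge0 X); case: (theta_upper X) => [t| |]//=.
  rewrite lte_fin => tr _; exists ((t + r) / 2); rewrite ?lte_fin; lra.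
have [c [x0 [c0 hc]]] := theta_upper_lt tu.
have [N0 _ hN0] := theta_hat_ge_decay 2 r0 ur c0 hc.
(* The shift places the index past N0, where the decay holds, and makes it at least k+2, for the
   comparison with 1/(k+2)^2. *)
pose A k := [set w | r < theta_hat Y (k + N0.+2) w].
have mA k : measurable (A k) by exact: measurable_theta_hat_gt.
have sA : (\sum_(k <oo) Q (A k) < +oo)%E.
  apply: le_lt_trans (_ : 1%:E < _)%E; last by rewrite ltry.
  apply: nneseries_le_bound => // n.
  apply: le_trans (_ : (\sum_(0 <= k < n) ((k.+2%:R : R) ^+ 2)^-1)%:E <= _)%E; last first.
    by rewrite lee_fin sum_invn2_le1.
  rewrite -sumEFin; apply: lee_sum => k _.
  rewrite -[leLHS]fineK ?fin_num_measure// lee_fin.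
  apply: (@le_trans _ _ (Pr Q [set w | r <= theta_hat Y (k + N0.+2) w])).
    apply: le_Pr => //; first exact: measurable_theta_hat_ge.
    by move=> w /= /ltW.
  apply: le_trans (hN0 _ _) _; first by rewrite /=; lia.
  have kN : 0 < (k + N0.+2)%:R :> R by rewrite ltr0n; lia.
  rewrite expRN mulrC expRM_natr lnK ?posrE// lef_pV2 ?posrE ?exprn_gt0//.
  by apply: lerXn2r; rewrite ?nnegrE// ler_nat; lia.
apply: filterS (ae_eventually_not mA sA) => w [N _ hN].
exists (N + N0.+2)%N => // n /= Nn.
rewrite leNgt; apply/negP => rn; apply: (hN (n - N0.+2)%N) => /=; first by lia.
by rewrite /A/= subnK//; lia.
Qed.

(** Bernoulli's inequality and Markov's at some s > r bound the probability by C n^(1 - s/r); for r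
    <= 0 the event is empty. *)
Lemma Pr_theta_hat_le_cvg0 (r : R) : (r%:E < theta X)%E ->
  Pr Q [set w | theta_hat Y n w <= r] @[n --> \oo] --> 0.
Proof.
move=> rt; have [r0|r0] := leP r 0.
  rewrite (_ : (fun n => _) = fun=> 0); first exact: cvg_cst.
  apply/funext => n; rewrite (_ : [set w | _] = set0) ?/Pr ?measure0//.
  by apply/seteqP; split => // w /=; rewrite leNgt (le_lt_trans r0)// theta_hat_gt0.
have [s [rs s0 /(markov_closed_tail s0)[C C0 hC]]] := lt_theta rt.
have b0 : 0 < s / r - 1 by rewrite subr_gt0 ltr_pdivlMr// mul1r.
apply/cvgrPdist_le => e e0; near=> n.
have n1 : 1 <= ln (n%:R : R) by near: n; exact: near_ln_ge.
have rn : r + 1 <= ln (n%:R : R) by near: n; exact: near_ln_ge.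
have en : (ln C - ln e) / (s / r - 1) <= ln (n%:R : R) by near: n; exact: near_ln_ge.
have n0 : 0 < n%:R :> R by rewrite ltNge; apply/negP => /ln0 h; rewrite h ler10 in n1.
rewrite sub0r normrN ger0_norm ?Pr_ge0//.
rewrite (Pr_theta_hat_le iidY)//; last by rewrite r0/= (lt_le_trans _ rn)// ltrDl.
set y := expR _.
apply: le_trans (_ : n%:R * closed_tail X y <= _).
  by have := bernoulli_le n (closed_tail_itv X y); lra.
apply: le_trans (ler_wpM2l _ (hC y _)) _ => //; first exact: expR_gt0.
rewrite /y -expRM -[leRHS]lnK ?posrE// -{1}(@lnK _ n%:R) ?posrE// -{1}(@lnK _ C) ?posrE//.
rewrite -!expRD ler_expR.
move: en; rewrite ler_pdivrMr// => en.
have -> : ln n%:R + (ln C + ln n%:R / r * - s) = ln C - ln n%:R * (s / r - 1).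
  by field; rewrite gt_eqF.
lra.
Unshelve. all: by end_near. Qed.

Lemma Pr_theta_hat_ge_cvg0 (u r c x0 : R) : 0 < r -> u < r -> 0 < c ->
  (forall x, x0 < x -> c <= x `^ u * tail X x) ->
  Pr Q [set w | r <= theta_hat Y n w] @[n --> \oo] --> 0.
Proof.
move=> r0 ur c0 hc; apply/cvgrPdist_le => e e0; near=> n.
rewrite sub0r normrN ger0_norm ?Pr_ge0//.
apply: le_trans (_ : expR (- (1 * ln n%:R)) <= _).
  by near: n; exact: (theta_hat_ge_decay 1 r0 ur c0 hc).
have : - ln e <= ln (n%:R : R) by near: n; exact: near_ln_ge.
by move=> en; rewrite -[leRHS]lnK ?posrE// ler_expR; lra.
Unshelve. all: by end_near. Qed.

(* The constant is 1/2 * 1/2: n P(|X| > x) >= 1/2 by Bernoulli's inequality, and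
   n <= 2 x^r. *)
Lemma tail_lower_of_cvg0 (r : R) : 0 < r ->
  Pr Q [set w | r <= theta_hat Y n w] @[n --> \oo] --> 0 ->
  exists x0, forall x, x0 < x -> 4^-1 <= x `^ r * tail X x.
Proof.
move=> r0 /cvgrPdist_le/(_ 2^-1 _)[|N _ hN]; first by rewrite invr_gt0.
have [N0 _ hN0] := near_ln_ge (Num.max 1 r).
set m := (maxn N N0).+1.
exists (Num.max 1 (expR (ln m%:R / r))) => x; rewrite gt_max => /andP[x1 xm].
have [n [nx1 nx2 nx3]] := nat_powR_approx (ltW x1) r0.
have mn : (m <= n)%N.
  rewrite -(ler_nat R); apply: le_trans nx1.
  rewrite -[leLHS]lnK ?posrE// -[leRHS]lnK ?posrE ?powR_gt0 ?(lt_trans ltr01)//.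
  rewrite ler_expR ln_powR mulrC -ler_pdivrMr// -ler_expR lnK ?posrE ?(lt_trans ltr01)//.
  exact: ltW.
have : Num.max 1 r <= ln (n%:R : R) by apply: hN0 => /=; move: mn; rewrite /m; lia.
rewrite ge_max => /andP[n1 rn].
have := Pr_theta_hat_ge_lower (r := r) (x := x) n1.
rewrite r0 rn nx3 (le_trans ler01 (ltW x1)) => /(_ isT isT) lowP.
have : `|0 - Pr Q [set w | r <= theta_hat Y n w]| <= 2^-1.
  by apply: hN => /=; move: mn; rewrite /m; lia.
rewrite sub0r normrN ger0_norm ?Pr_ge0// => upP.
have /andP[G0 _] := tail_itv X x.
by have := ler_wpM2r G0 nx2; rewrite -mulrA; lra.
Qed.

End theta_hat_limsup.

(** * Upper and lower limits tested at rational levels *)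

Lemma lte_rat_dense (R : realType) (x y : \bar R) : (x < y)%E ->
  exists q : rat, (x < (ratr q)%:E < y)%E.
Proof.
case: x => [x| |]; case: y => [y| |]//; rewrite ?lte_fin => xy.
- have [q] := rat_in_itvoo xy; rewrite in_itv/= => /andP[xq qy].
  by exists q; rewrite !lte_fin xq.
- have [|q] := @rat_in_itvoo _ x (x + 1); first by rewrite ltrDl.
  rewrite in_itv/= => /andP[xq _].
  by exists q; rewrite lte_fin xq ltry.
- have [|q] := @rat_in_itvoo _ (y - 1) y; first by rewrite gtrBl.
  rewrite in_itv/= => /andP[_ qy].
  by exists q; rewrite lte_fin qy ltNyr.
- by exists 0; rewrite ltNyr ltry.
Qed.

(** Only rational levels are tested, so that countably many almost sure statements suffice to
    identify the limit. *)
Lemma limn_esup_eq (R : realType) (u : nat -> \bar R) (l : \bar R) :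
  (forall q : rat, (l < (ratr q)%:E)%E ->
     \forall n \near \oo, (u n <= (ratr q)%:E)%E) ->
  (forall q : rat, ((ratr q)%:E < l)%E ->
     forall N, exists2 n, (N <= n)%N & ((ratr q)%:E <= u n)%E) ->
  limn_esup u = l.
Proof.
move=> up lo; apply/eqP; rewrite eq_le; apply/andP; split; rewrite leNgt.
- apply/negP => /lte_rat_dense[q /andP[lq]]; apply/negP; rewrite -leNgt.
  apply: (@le_trans _ _ (ereal_sup (u @` [set n | (u n <= (ratr q)%:E)%E]))).
    by apply: ereal_inf_lbound; exists [set n | (u n <= (ratr q)%:E)%E] => //; exact: up.
  by apply: ge_ereal_sup => _ [n /= un <-].
- apply/negP => /lte_rat_dense[q /andP[+ ql]].
  move=> /ereal_inf_lt[_ [V [N _ NV] <-]]; apply/negP; rewrite -leNgt.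
  have [n Nn qn] := lo _ ql N; apply: le_trans qn _.
  by apply: ereal_sup_ubound; exists n => //; exact: NV.
Qed.

Lemma limn_einf_eq (R : realType) (u : nat -> \bar R) (l : \bar R) :
  (forall q : rat, ((ratr q)%:E < l)%E ->
     \forall n \near \oo, ((ratr q)%:E <= u n)%E) ->
  (forall q : rat, (l < (ratr q)%:E)%E ->
     forall N, exists2 n, (N <= n)%N & (u n <= (ratr q)%:E)%E) ->
  limn_einf u = l.
Proof.
move=> lo up; rewrite -[RHS]oppeK; congr oppe; apply: limn_esup_eq => q.
- rewrite lteNl -EFinN -raddfN => /lo; apply: filterS => n.
  by rewrite raddfN/= EFinN leeNl.
- rewrite lteNr -EFinN -raddfN => /up h N; have [n Nn un] := h N; exists n => //.
  by move: un; rewrite raddfN/= EFinN leeNr.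
Qed.

Lemma limn_einf_esup_cvg (R : realType) (u : nat -> \bar R) (l : \bar R) :
  limn_einf u = l -> limn_esup u = l -> u @ \oo --> l.
Proof.
move=> infl supl; apply: (@squeeze_cvge _ _ _ _ (einfs u) _ (esups u)).
- apply: nearW => n; apply/andP; split.
    by apply: ereal_inf_lbound; exists n => /=.
  by apply: ereal_sup_ubound; exists n => /=.
- by rewrite -infl limn_einf_lim; exact: is_cvg_einfs.
- by rewrite -supl limn_esup_lim; exact: is_cvg_esups.
Qed.

Lemma near_ln_pinfty (R : realType) (a : R) : \forall x \near +oo, a <= ln (x : R).
Proof.
near=> x.
have ax : expR a <= x by near: x; apply: nbhs_pinfty_ge; exact: num_real.
rewrite -[leLHS]expRK ler_ln ?posrE ?expR_gt0//.
Unshelve. all: by end_near. Qed.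

(** Extracts a deterministic fact from an almost sure one. *)
Lemma ae_ex d (T : measurableType d) (R : realType) (P : probability T R)
  (F : T -> Prop) : {ae P, forall w, F w} -> exists w, F w.
Proof.
move=> [N [mN PN0 FN]]; apply: contrapT => h.
have NT : N = setT by apply/seteqP; split => // w _; apply: FN => /= Fw; apply: h; exists w.
by move/eqP: PN0; rewrite NT probability_setT onee_eq0.
Qed.

(** * Consistency of theta_hat *)

Section tail_exponent.
Context (R : realType) (d : measure_display) (T : measurableType d)
  (P : probability T R) (X : {RV P >-> R}).

(** Half of e goes to the exponent: [theta_upper X] < th + e/2 bounds the tail below, and a finite
    moment of order above th - e/2 bounds it above. The other half absorbs the constants ln c and ln
    C. *)
Lemma tail_log_bounds (th e : R) : theta X = th%:E -> (theta_upper X <= theta X)%E ->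
  0 < e -> \forall x \near +oo, [/\ 0 < ln x, 0 < tail X x,
    (- th - e) * ln x <= ln (tail X x) & ln (closed_tail X x) <= (- th + e) * ln x].
Proof.
move=> thE upth e0.
have [c [x0 [c0 hc]]] : exists c x0, 0 < c /\
    forall x, x0 < x -> c <= x `^ (th + e / 2) * tail X x.
  apply: theta_upper_lt; apply: le_lt_trans upth _; rewrite thE lte_fin; lra.
have [C C0 hC] : exists2 C, 0 < C & forall x, 1 <= x ->
    closed_tail X x <= C * x `^ (- (th - e / 2)).
  by apply: closed_tail_bound; rewrite thE lte_fin; lra.
near=> x.
have x1 : 1 < x by near: x; apply: nbhs_pinfty_gt; exact: num_real.
have x0x : x0 < x by near: x; apply: nbhs_pinfty_gt; exact: num_real.
have xgt0 : 0 < x := lt_trans ltr01 x1.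
have lnx : 0 < ln x by exact: ln_gt0.
have G0 : 0 < tail X x.
  have := lt_le_trans c0 (hc _ x0x).
  by rewrite pmulr_rgt0// powR_gt0.
have G'0 : 0 < closed_tail X x := lt_le_trans G0 (tail_le_closed_tail X x).
split => //.
- have : ln c <= ln (x `^ (th + e / 2) * tail X x).
    by rewrite ler_ln ?posrE ?mulr_gt0 ?powR_gt0//; exact: hc.
  rewrite lnM ?posrE ?powR_gt0// ln_powR.
  have : - ln c / (e / 2) <= ln x by near: x; exact: near_ln_pinfty.
  rewrite ler_pdivrMr ?divr_gt0//; lra.
- have : ln (closed_tail X x) <= ln (C * x `^ (- (th - e / 2))).
    by rewrite ler_ln ?posrE ?mulr_gt0 ?powR_gt0//; apply: hC; exact: ltW.
  rewrite lnM ?posrE ?powR_gt0// ln_powR.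
  have : ln C / (e / 2) <= ln x by near: x; exact: near_ln_pinfty.
  rewrite ler_pdivrMr ?divr_gt0//; lra.
Unshelve. all: by end_near. Qed.

Lemma cvg_ln_tail (th : R) : theta X = th%:E -> (theta_upper X <= theta X)%E ->
  ln (tail X x) / ln x @[x --> +oo] --> - th /\
  ln (closed_tail X x) / ln x @[x --> +oo] --> - th.
Proof.
move=> thE upth; split; apply/cvgrPdist_le => e e0.
all: apply: filterS (tail_log_bounds thE upth e0) => x [lnx G0 lo up].
all: have GG' : ln (tail X x) <= ln (closed_tail X x).
1,3: by rewrite ler_ln ?posrE ?(lt_le_trans G0 (tail_le_closed_tail X x))//;
  exact: tail_le_closed_tail.
all: rewrite ler_norml; apply/andP; split.
1,3: rewrite lerBrDr -lerBrDl opprK ler_pdivrMr//; lra.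
all: rewrite lerBlDr -lerBlDl ler_pdivlMr//; lra.
Qed.

(** Forward, a positive lower bound at the midpoint of theta and r leaves the factor x^((r - th)/2),
    which diverges. Backward, divergence at th + e gives a lower bound there, so [theta_upper X] is
    at most th + e for every e. *)
Lemma theta_upper_le_thetaP : (theta_upper X <= theta X)%E <->
  ((theta X < +oo)%E -> forall r : R, (theta X < r%:E)%E ->
     x `^ r * tail X x @[x --> +oo] --> +oo).
Proof.
split=> [upth thfin r|h].
  move: thfin upth (theta_ge0 X); case thE : (theta X) => [th| |]// _ upth _.
  rewrite lte_fin => thr.
  have [c [x0 [c0 hc]]] : exists c x0, 0 < c /\
      forall x, x0 < x -> c <= x `^ ((th + r) / 2) * tail X x.
    by apply: theta_upper_lt; apply: le_lt_trans upth _; rewrite lte_fin; lra.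
  apply/cvgryPge => a; near=> x.
  have x0x : x0 < x by near: x; apply: nbhs_pinfty_gt; exact: num_real.
  have xgt0 : 0 < x by near: x; apply: nbhs_pinfty_gt; exact: num_real.
  rewrite -[r](subrK ((th + r) / 2)) powRD ?(gt_eqF xgt0) ?implybT// -mulrA.
  apply: le_trans (ler_wpM2l (powR_ge0 _ _) (hc _ x0x)).
  rewrite -ler_pdivrMr//; apply: le_trans (_ : Num.max 1 (a / c) <= _).
    by rewrite le_max lexx orbT.
  rewrite -[leLHS]lnK ?posrE ?lt_max ?ltr01//.
  have rd : 0 < r - (th + r) / 2 by lra.
  rewrite /powR gt_eqF// ler_expR [leRHS]mulrC -ler_pdivrMr//.
  by near: x; exact: near_ln_pinfty.
move: h (theta_ge0 X); case: (theta X) => [th| |]//; last by move=> _ _; exact: leey.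
move=> /(_ (ltry _)) h _; apply/lee_addgt0Pr => e e0.
have /h/cvgryPge/(_ 1)[x0 [_ hx0]] : (th%:E < (th + e)%:E)%E by rewrite lte_fin ltrDl.
exact: theta_upper_le ltr01 hx0.
Unshelve. all: by end_near. Qed.

(** The witness is x^th P(|X| > x) itself. Conversely L(x) >= x^(-e) for large x, so x^(th + e)
    P(|X| > x) >= 1/2 there. *)
Lemma theta_upper_le_theta_slowly_varying (th : R) : theta X = th%:E ->
  (theta_upper X <= theta X)%E <-> exists L : R -> R,
         [/\ forall x, 0 < x -> 0 < L x,
             asym_equiv (tail X) (fun x => L x / x `^ th)
           & ln (L x) / ln x @[x --> +oo] --> (0 : R)].
Proof.
move=> thE; split=> [upth|[L [L0 GL lnL]]].
(* L has to be positive on the whole half-line: the tail is positive far out, hence everywhere by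
   monotonicity. *)
- have G0 x : 0 < tail X x.
    have [y [_ hy]] := tail_log_bounds thE upth ltr01.
    have [|_ Gy _ _] := hy (Num.max x y + 1).
      by rewrite ltr_pwDr// le_max lexx orbT.
    apply: lt_le_trans Gy (tail_nincr _ _).
    by rewrite ler_wpDr// le_max lexx.
  exists (fun x => x `^ th * tail X x); split => [x x0||].
  + by rewrite mulr_gt0// powR_gt0.
  + rewrite /asym_equiv; have : (fun=> 1 : R) @ (+oo : set_system R) --> (1 : R) by exact: cvg_cst.
    apply: cvg_trans; apply: near_eq_cvg; near=> x.
    have xgt0 : 0 < x by near: x; apply: nbhs_pinfty_gt; exact: num_real.
    by rewrite [_ * tail X x]mulrC mulfK ?gt_eqF ?powR_gt0// divff ?gt_eqF.
  + rewrite -(subrr th); have [+ _] := cvg_ln_tail thE upth.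
    move=> /(cvgD (cvg_cst th)); apply: cvg_trans; apply: near_eq_cvg; near=> x.
    have xgt1 : 1 < x by near: x; apply: nbhs_pinfty_gt; exact: num_real.
    have xgt0 : 0 < x := lt_trans ltr01 xgt1.
    rewrite lnM ?posrE ?powR_gt0// ln_powR mulrDl mulfK//.
    by rewrite gt_eqF// ln_gt0.
- rewrite thE; apply/lee_addgt0Pr => e e0.
  have : \forall x \near +oo, 2^-1 <= x `^ (th + e) * tail X x.
    near=> x.
    have xgt1 : 1 < x by near: x; apply: nbhs_pinfty_gt; exact: num_real.
    have xgt0 : 0 < x := lt_trans ltr01 xgt1.
    have : `|1 - tail X x / (L x / x `^ th)| <= 2^-1.
      by near: x; move/cvgrPdist_le : GL; apply; rewrite invr_gt0.
    have : `|0 - ln (L x) / ln x| <= e.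
      by near: x; move/cvgrPdist_le : lnL; exact.
    rewrite sub0r normrN ler_norml => /andP[+ _].
    rewrite ler_pdivlMr ?ln_gt0// => Lx.
    rewrite ler_norml => /andP[_ ]; rewrite lerBlDr -lerBlDl => GLx.
    have {}GLx : 2^-1 <= tail X x / (L x / x `^ th) by lra.
    move: GLx; rewrite ler_pdivlMr ?divr_gt0 ?L0 ?powR_gt0// => GLx.
    apply: le_trans (ler_wpM2l (powR_ge0 _ _) GLx).
    rewrite powRD ?(gt_eqF xgt0) ?implybT//.
    have -> : x `^ th * x `^ e * (2^-1 * (L x / x `^ th)) = 2^-1 * (x `^ e * L x).
      by field; rewrite gt_eqF ?powR_gt0.
    rewrite ler_peMr ?invr_ge0//.
    rewrite -[X in _ * X]lnK ?posrE ?L0// /powR gt_eqF// -expRD -[leLHS]expR0 ler_expR.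
    by move: Lx; lra.
  by move=> [x0 [_ hx0]]; apply: (@theta_upper_le _ _ _ _ _ _ 2^-1 x0).
Unshelve. all: by end_near. Qed.

End tail_exponent.

Section theta_hat_consistency.
Context (R : realType)
    (d : measure_display) (T : measurableType d) (P : probability T R)
    (d' : measure_display) (T' : measurableType d') (Q : probability T' R)
    (X : {RV P >-> R}) (Y : nat -> {RV Q >-> R}) (iidY : iid_copies X Y).

Lemma ae_forall_rat (F : rat -> T' -> Prop) :
  (forall q, {ae Q, forall w, F q w}) -> {ae Q, forall w, forall q, F q w}.
Proof.
move=> h.
have : {ae Q, forall w, forall n : nat, if unpickle n is Some q then F q w else True}.
  by apply: ae_foralln => n; case: (unpickle n) => [q|]; [exact: h|exact: aeW].
by apply: filterS => w + q => /(_ (pickle q)); rewrite pickleK.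
Qed.

Lemma theta_hat_liminf_limsup : {ae Q, forall w,
  limn_einf (fun n => (theta_hat Y n w)%:E) = theta X /\
  limn_esup (fun n => (theta_hat Y n w)%:E) = theta_upper X}.
Proof.
have h1 := ae_forall_rat (F := fun q w => ((ratr q)%:E < theta X)%E ->
  \forall n \near \oo, (ratr q : R) <= theta_hat Y n w).
have h2 := ae_forall_rat (F := fun q w => (theta X < (ratr q)%:E)%E ->
  forall N, exists2 n, (N <= n)%N & theta_hat Y n w <= ratr q).
have h3 := ae_forall_rat (F := fun q w => (theta_upper X < (ratr q)%:E)%E ->
  \forall n \near \oo, theta_hat Y n w <= ratr q).
have h4 := ae_forall_rat (F := fun q w => ((ratr q)%:E < theta_upper X)%E ->
  forall N, exists2 n, (N <= n)%N & ratr q <= theta_hat Y n w).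
(* The comparison of q with the exponent does not involve w, so it can be moved inside the almost
   sure quantifier. *)
have imp (b : bool) (F : T' -> Prop) : (b -> {ae Q, forall w, F w}) ->
    {ae Q, forall w, b -> F w}.
  by case: b => [/(_ isT)|_]; [apply: filterS => w Fw _|exact: aeW].
have {}h1 := h1 (fun q => imp _ _ (@theta_hat_eventually_ge _ _ _ _ _ _ _ _ _ iidY _)).
have {}h2 := h2 (fun q => imp _ _ (@theta_hat_often_le _ _ _ _ _ _ _ _ _ iidY _)).
have {}h3 := h3 (fun q => imp _ _ (@theta_hat_eventually_le _ _ _ _ _ _ _ _ _ iidY _)).
have {}h4 := h4 (fun q => imp _ _ (@theta_hat_often_ge _ _ _ _ _ _ _ _ _ iidY _)).
near=> w; split.
- apply: limn_einf_eq => q hq.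
  + have : forall q : rat, ((ratr q)%:E < theta X)%E ->
      \forall n \near \oo, (ratr q : R) <= theta_hat Y n w by near: w; exact: h1.
    by move=> /(_ q hq); apply: filterS => n; rewrite lee_fin.
  + have : forall q : rat, (theta X < (ratr q)%:E)%E ->
      forall N, exists2 n, (N <= n)%N & theta_hat Y n w <= ratr q by near: w; exact: h2.
    by move=> /(_ q hq) h N; have [n Nn hn] := h N; exists n; rewrite ?lee_fin.
- apply: limn_esup_eq => q hq.
  + have : forall q : rat, (theta_upper X < (ratr q)%:E)%E ->
      \forall n \near \oo, theta_hat Y n w <= ratr q by near: w; exact: h3.
    by move=> /(_ q hq); apply: filterS => n; rewrite lee_fin.
  + have : forall q : rat, ((ratr q)%:E < theta_upper X)%E ->
      forall N, exists2 n, (N <= n)%N & ratr q <= theta_hat Y n w by near: w; exact: h4.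
    by move=> /(_ q hq) h N; have [n Nn hn] := h N; exists n; rewrite ?lee_fin.
Unshelve. all: by end_near. Qed.

(** The almost sure lower limit never exceeds the upper one, so convergence to theta amounts to the
    reverse inequality between the two constants. *)
Lemma theta_hat_cvg_aeP :
  {ae Q, forall w, (theta_hat Y n w)%:E @[n --> \oo] --> theta X} <->
  (theta_upper X <= theta X)%E.
Proof.
split=> [h|upth].
- have : {ae Q, forall w, (theta_upper X <= theta X)%E}.
    apply: filterS2 h theta_hat_liminf_limsup => w /cvg_limn_einf_sup[_ <-].
    by move=> [_ ->].
  by move=> /ae_ex[].
- apply: filterS theta_hat_liminf_limsup => w [infE supE].
  apply: limn_einf_esup_cvg => //; rewrite supE; apply/eqP; rewrite eq_le upth/=.
  by rewrite -infE -supE limn_einf_sup.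
Qed.

Lemma theta_hat_cvg_in_probabilityP :
  cvg_in_probability Q (theta_hat Y) (theta X) <-> (theta_upper X <= theta X)%E.
Proof.
case thE : (theta X) (theta_ge0 X) => [th| |]// => [|_]; last first.
  split=> [_|_]; first by rewrite leey.
  move=> M.
  rewrite (_ : (fun n => _) = fun n => 1 - Pr Q [set w | theta_hat Y n w <= M]).
    rewrite -[X in _ --> X]subr0; apply: cvgB; first exact: cvg_cst.
    by apply: (Pr_theta_hat_le_cvg0 iidY); rewrite thE ltry.
  apply/funext => n.
  rewrite (_ : [set w | M < theta_hat Y n w] = ~` [set w | theta_hat Y n w <= M]).
    by rewrite /Pr probability_setC ?fineB ?fin_num_measure//; exact: measurable_theta_hat_le.
  by apply/seteqP; split => w /=; rewrite ltNge => /negP.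
rewrite lee_fin => th0; split=> [h|upth e e0].
  apply/lee_addgt0Pr => e e0.
  (* Convergence in probability concerns strict deviations; a deviation of at least e is strictly
     more than e/2. *)
  have e20 : 0 < e / 2 by rewrite divr_gt0.
  have thd : 0 < th + e by rewrite ltr_wpDl.
  suff /(tail_lower_of_cvg0 iidY thd)[x0 hx0] :
      Pr Q [set w | th + e <= theta_hat Y n w] @[n --> \oo] --> 0.
    by apply: (@theta_upper_le _ _ _ _ _ _ 4^-1 x0).
  have {}h := h _ e20; apply: (@squeeze_cvgr _ _ _ _ (fun=> 0) _ _ _ _ _ h).
    apply: nearW => n.
    rewrite Pr_ge0/=; apply: le_Pr.
    - exact: measurable_theta_hat_ge.
    - apply: measurable_set_lt => //; apply: (measurableT_comp (@normr_measurable R setT)).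
      by apply: measurable_funB => //; exact: measurable_theta_hat.
    - by move=> w /= hw; rewrite ger0_norm; lra.
  exact: cvg_cst.
have [c [x0 [c0 hc]]] : exists c x0, 0 < c /\
    forall x, x0 < x -> c <= x `^ (th + e / 2) * tail X x.
  by apply: theta_upper_lt; apply: le_lt_trans upth _; rewrite lte_fin; lra.
have up : Pr Q [set w | th + e <= theta_hat Y n w] @[n --> \oo] --> 0.
  by apply: (Pr_theta_hat_ge_cvg0 iidY _ _ c0 hc); lra.
have lo : Pr Q [set w | theta_hat Y n w <= th - e] @[n --> \oo] --> 0.
  by apply: (Pr_theta_hat_le_cvg0 iidY); rewrite thE lte_fin; lra.
have loup : Pr Q [set w | theta_hat Y n w <= th - e] +
    Pr Q [set w | th + e <= theta_hat Y n w] @[n --> \oo] --> 0.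
  by rewrite -[X in _ --> X]addr0; exact: cvgD lo up.
apply: (@squeeze_cvgr _ _ _ _ (fun=> 0) _ _ _ _ _ loup); last exact: cvg_cst.
apply: nearW => n; rewrite Pr_ge0/=.
have mge := measurable_theta_hat_ge Y n (th + e).
have mle := measurable_theta_hat_le Y n (th - e).
apply: le_trans (_ : Pr Q ([set w | theta_hat Y n w <= th - e] `|`
    [set w | th + e <= theta_hat Y n w]) <= _).
  apply: le_Pr; last 1 first.
  - by move=> w /=; rewrite ltr_normr => /orP[]?; [right|left]; lra.
  - apply: measurable_set_lt => //; apply: (measurableT_comp (@normr_measurable R setT)).
    by apply: measurable_funB => //; exact: measurable_theta_hat.
  - exact: measurableU.
rewrite /Pr -fineD ?fin_num_measure// fine_le ?fin_num_measure ?fin_numD//.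
- exact: measurableU.
- by rewrite !fin_num_measure.
- exact: measureU2.
Qed.

End theta_hat_consistency.

Lemma cvg_ln_nat_pinfty (R : realType) : ln (n%:R : R) @[n --> \oo] --> +oo.
Proof. by apply/cvgryPge => a; exact: near_ln_ge. Qed.

Lemma cvg_expR_pinfty (R : realType) : @expR R x @[x --> +oo] --> +oo.
Proof.
apply/cvgryPge => a; near=> x.
apply: le_trans (_ : 1 + x <= _); last exact: expR_ge1Dx.
rewrite -lerBlDl; near: x; apply: nbhs_pinfty_ge; exact: num_real.
Unshelve. all: by end_near. Qed.

Lemma cvg_expR_ln_div (R : realType) (r : R) : 0 < r ->
  expR (ln (n%:R : R) / r) @[n --> \oo] --> +oo.
Proof.
move=> r0; apply: cvg_comp (@cvg_expR_pinfty R).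
apply/cvgryPge => a; near=> n; rewrite ler_pdivlMr//.
by near: n; exact: near_ln_ge.
Unshelve. all: by end_near. Qed.

(** The probability estimates below are sharp up to a factor 2; this becomes an additive ln 2, which
    division by ln n removes. *)
Lemma ratio_ln_bounded_diff (R : realType) (v w : nat -> R) (l c : R) :
  w n / ln n%:R @[n --> \oo] --> l -> (\forall n \near \oo, `|v n - w n| <= c) ->
  v n / ln n%:R @[n --> \oo] --> l.
Proof.
move=> wl vw; apply/cvgrPdist_le => e e0; near=> n.
have ln0 : 0 < ln (n%:R : R) by apply: lt_le_trans ltr01 _; near: n; exact: near_ln_ge.
have : `|l - w n / ln n%:R| <= e / 2.
  by near: n; move/cvgrPdist_le : wl; apply; rewrite divr_gt0.
have : c / (e / 2) <= ln n%:R by near: n; exact: near_ln_ge.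
rewrite ler_pdivrMr ?divr_gt0// => cn ln_l.
have vwn : `|v n - w n| <= c by near: n.
rewrite (_ : _ - _ = (l - w n / ln n%:R) - (v n - w n) / ln n%:R); last by ring.
apply: le_trans (ler_normB _ _) _; rewrite [leRHS]splitr lerD//.
by rewrite normrM normfV (gtr0_norm ln0) ler_pdivrMr//; lra.
Unshelve. all: by end_near. Qed.

(** With u = n p <= 1, the lower bound is (1 - p)^n <= exp(-u) <= 1/(1 + u) <= 1 - u/2. *)
Lemma one_sub_expr_bounds (R : realType) (p : R) (n : nat) : 0 <= p <= 1 ->
  n%:R * p <= 1 -> n%:R * p / 2 <= 1 - (1 - p) ^+ n <= n%:R * p.
Proof.
move=> p01 np1; have /andP[p0 p1] := p01.
have := bernoulli_le n p01; have := expr_le_expR n p1.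
set u := n%:R * p in np1 *; have u0 : 0 <= u by rewrite mulr_ge0.
have eu : expR (- u) <= (1 + u)^-1.
  by rewrite expRN lef_pV2 ?posrE ?expR_gt0 ?expR_ge1Dx ?ltr_wpDr.
have : (1 + u)^-1 <= 1 - u / 2.
  rewrite -[leLHS]mul1r ler_pdivrMr ?ltr_wpDr//.
  have : 0 <= u * (1 - u) by rewrite mulr_ge0// subr_ge0.
  lra.
move=> *; apply/andP; split; lra.
Qed.

Lemma ln_one_sub_bounds (R : realType) (q : R) : 0 <= q <= 2^-1 ->
  q <= - ln (1 - q) <= 2 * q.
Proof.
move=> /andP[q0 q2]; have q1 : 0 < 1 - q by lra.
apply/andP; split; first by rewrite lerNr; apply: le_ln1Dx; lra.
rewrite -lnV ?posrE//.
have -> : (1 - q)^-1 = 1 + q / (1 - q) by field; rewrite gt_eqF.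
have qq : q / (1 - q) <= 2 * q.
  rewrite ler_pdivrMr//; have : 0 <= q * (1 - 2 * q) by rewrite mulr_ge0//; lra.
  lra.
apply: le_trans qq; apply: le_ln1Dx.
by apply: lt_le_trans (_ : 0 <= _); [lra|rewrite divr_ge0// ltW].
Qed.

(** * Rates of convergence *)

Section large_deviations.
Context (R : realType)
    (d : measure_display) (T : measurableType d) (P : probability T R)
    (d' : measure_display) (T' : measurableType d') (Q : probability T' R)
    (X : {RV P >-> R}) (Y : nat -> {RV Q >-> R}) (iidY : iid_copies X Y)
    (th : R) (thE : theta X = th%:E) (th0 : 0 < th)
    (upth : (theta_upper X <= theta X)%E).

(** Growth exponent of n Z(n^(1/r)), with [Z] either of the two tails: negative for r < th, positive
    for r > th. *)
Lemma cvg_ln_n_tail (Z : R -> R) (r : R) : 0 < r ->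
  ln (Z x) / ln x @[x --> +oo] --> - th ->
  (ln n%:R + ln (Z (expR (ln n%:R / r)))) / ln n%:R @[n --> \oo] --> 1 - th / r.
Proof.
move=> r0 Zth.
have := cvg_comp _ _ (cvg_expR_ln_div r0) Zth; rewrite /comp/= => h.
have {}h : 1 + ln (Z (expR (ln (n%:R : R) / r))) / ln (expR (ln n%:R / r)) / r
    @[n --> \oo] --> 1 - th / r.
  by rewrite -mulNr; apply: cvgD; [exact: cvg_cst|apply: cvgM => //; exact: cvg_cst].
apply: cvg_trans h; apply: near_eq_cvg; near=> n.
have ln0 : 0 < ln (n%:R : R) by apply: lt_le_trans ltr01 _; near: n; exact: near_ln_ge.
by rewrite expRK; field; rewrite !gt_eqF.
Unshelve. all: by end_near. Qed.

Lemma near_tail_gt0 (r : R) : 0 < r -> \forall n \near \oo,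
  0 < tail X (expR (ln (n%:R : R) / r)).
Proof.
move=> r0; have h : \forall x \near +oo, 0 < tail X x.
  by apply: filterS (tail_log_bounds thE upth ltr01) => x [].
exact: cvg_expR_ln_div r0 _ h.
Qed.

(** Below th the quantity n P(|X| >= n^(1/r)) tends to 0, so it equals the probability up to a
    factor 2. Positivity is recorded too, since logarithms of this probability are compared again
    later. *)
Lemma Pr_theta_hat_le_exponent (s : R) : 0 < s -> s < th ->
  (\forall n \near \oo, 0 < Pr Q [set w | theta_hat Y n w <= th - s]) /\
  ln (Pr Q [set w | theta_hat Y n w <= th - s]) / ln (n%:R : R)
           @[n --> \oo] --> - (s / (th - s)).
Proof.
move=> s0 sth; set r := th - s; have r0 : 0 < r by rewrite subr_gt0.
have [_ Zth] := cvg_ln_tail thE upth.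
have w_l := cvg_ln_n_tail r0 Zth.
have lE : 1 - th / r = - (s / r) by rewrite /r; field; rewrite subr_eq0 gt_eqF.
have l0 : 1 - th / r < 0 by rewrite lE oppr_lt0 divr_gt0.
rewrite lE in w_l l0.
have near_bounds : \forall n \near \oo, [/\ 0 < n%:R * closed_tail X (expR (ln n%:R / r)),
    ln (n%:R * closed_tail X (expR (ln n%:R / r))) =
      ln n%:R + ln (closed_tail X (expR (ln n%:R / r))) &
    n%:R * closed_tail X (expR (ln n%:R / r)) / 2 <=
      Pr Q [set w | theta_hat Y n w <= r] <=
      n%:R * closed_tail X (expR (ln n%:R / r))].
  near=> n.
  have n1 : 1 <= ln (n%:R : R) by near: n; exact: near_ln_ge.
  have rn : r + 1 <= ln (n%:R : R) by near: n; exact: near_ln_ge.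
  have n0 : 0 < n%:R :> R by rewrite ltNge; apply/negP => /ln0 h; rewrite h ler10 in n1.
  have G0 : 0 < closed_tail X (expR (ln n%:R / r)).
    apply: lt_le_trans (tail_le_closed_tail X _).
    by near: n; exact: near_tail_gt0.
  have lnnp : ln (n%:R * closed_tail X (expR (ln n%:R / r))) =
      ln n%:R + ln (closed_tail X (expR (ln n%:R / r))) by rewrite lnM.
  have np0 : 0 < n%:R * closed_tail X (expR (ln n%:R / r)) by rewrite mulr_gt0.
  split => //.
  rewrite (Pr_theta_hat_le iidY)//; last by rewrite r0/= (lt_le_trans _ rn)// ltrDl.
  apply: one_sub_expr_bounds; first exact: closed_tail_itv.
  rewrite -[leLHS]lnK ?posrE// -[leRHS]expR0 ler_expR lnnp.
  have : (ln n%:R + ln (closed_tail X (expR (ln n%:R / r)))) / ln n%:R <= 0.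
    by near: n; apply: cvgr_le w_l _ l0.
  by rewrite ler_pdivrMr ?mul0r// (lt_le_trans ltr01).
split.
  apply: filterS near_bounds => n [np0 _ /andP[+ _]]; apply: lt_le_trans.
  by rewrite divr_gt0.
apply: (ratio_ln_bounded_diff (c := ln 2) w_l).
apply: filterS near_bounds => n [np0 <- /andP[lo up]].
have P0 : 0 < Pr Q [set w | theta_hat Y n w <= r].
  by apply: lt_le_trans lo; rewrite divr_gt0.
have ln2 : 0 <= ln 2 :> R by rewrite ln_ge0// ler1n.
have := up; rewrite -ler_ln ?posrE// => {}up.
have := lo; rewrite -ler_ln ?posrE ?divr_gt0// ln_div ?posrE// => {}lo.
by rewrite ler_norml; lra.
Unshelve. all: by end_near. Qed.

(** The negated logarithm of (1 - q)^n lies between n q and 2 n q, and above th the product n q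
    grows like a positive power of n. *)
Lemma Pr_theta_hat_ge_exponent (t : R) : 0 < t ->
  log (- ln (Pr Q [set w | theta_hat Y n w >= th + t])) / ln (n%:R : R)
           @[n --> \oo] --> t / (th + t).
Proof.
move=> t0; set r := th + t; have r0 : 0 < r by rewrite addr_gt0.
have [Zth _] := cvg_ln_tail thE upth.
have w_l := cvg_ln_n_tail r0 Zth.
have lE : 1 - th / r = t / r by rewrite /r; field; rewrite gt_eqF.
have l0 : 0 < t / r by rewrite divr_gt0.
rewrite lE in w_l.
apply: (ratio_ln_bounded_diff (c := ln 2) w_l).
near=> n.
have n1 : 1 <= ln (n%:R : R) by near: n; exact: near_ln_ge.
have rn : r <= ln (n%:R : R) by near: n; exact: near_ln_ge.
have tn : 1 / (t / r / 2) <= ln (n%:R : R) by near: n; exact: near_ln_ge.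
have n0 : 0 < n%:R :> R by rewrite ltNge; apply/negP => /ln0 h; rewrite h ler10 in n1.
have G0 : 0 < tail X (expR (ln n%:R / r)) by near: n; exact: near_tail_gt0.
have G2 : tail X (expR (ln n%:R / r)) <= 2^-1.
  near: n; apply: (cvgr_le _ (cvg_comp _ _ (cvg_expR_ln_div r0) (@cvg_tail0 _ _ _ _ X))).
  by rewrite invr_gt0.
(* Makes the truncation inside [log] inactive. *)
have nq1 : 1 <= ln n%:R + ln (tail X (expR (ln n%:R / r))).
  apply: le_trans (_ : t / r / 2 * ln n%:R <= _).
    by rewrite mulrC -ler_pdivrMr// divr_gt0.
  rewrite -ler_pdivlMr ?(lt_le_trans ltr01)//.
  near: n; apply: cvgr_ge w_l _ _.
  by rewrite ltr_pdivrMr// ltr_pMr// ltr1n.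
rewrite (Pr_theta_hat_ge iidY) ?r0//.
set q := tail X _ in G0 G2 nq1 *.
have q1 : 0 < 1 - q by lra.
have q02 : 0 <= q <= 2^-1 by rewrite G2 ltW.
have /andP[lo up] := ln_one_sub_bounds q02.
rewrite lnXn// -[_ *+ n]mulr_natl -mulrN.
set v := - ln (1 - q) in lo up *.
have v0 : 0 < v := lt_le_trans G0 lo.
have lov : ln q <= ln v by rewrite ler_ln ?posrE.
have upv : ln v <= ln 2 + ln q by rewrite -lnM ?posrE// ler_ln ?posrE// mulr_gt0.
have lnv : ln (n%:R * v) = ln n%:R + ln v by rewrite lnM ?posrE.
have ln2 : 0 <= ln 2 :> R by rewrite ln_ge0// ler1n.
rewrite logE lnv; last lra.
by rewrite ler_norml; lra.
Unshelve. all: by end_near. Qed.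

Lemma Pr_theta_hat_dist_exponent (eps : R) : 0 < eps -> eps < th ->
  ln (Pr Q [set w | `|theta_hat Y n w - th| >= eps]) / ln (n%:R : R)
           @[n --> \oo] --> - (eps / (th - eps)).
Proof.
move=> e0 eth; have [lo0 lo_l] := Pr_theta_hat_le_exponent e0 eth.
apply: (ratio_ln_bounded_diff (c := ln 2) lo_l).
have [c [x0 [c0 hc]]] : exists c x0, 0 < c /\
    forall x, x0 < x -> c <= x `^ (th + eps / 2) * tail X x.
  by apply: theta_upper_lt; apply: le_lt_trans upth _; rewrite thE lte_fin; lra.
have the0 : 0 < th + eps by rewrite addr_gt0.
have the1 : th + eps / 2 < th + eps by lra.
(* One more than the decay exponent of the lower deviation, which therefore dominates the upper one;
   the union has at most twice its probability. *)
set k := eps / (th - eps) + 1.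
have decay := theta_hat_ge_decay iidY k the0 the1 c0 hc.
near=> n.
have ln0 : 0 < ln (n%:R : R) by apply: lt_le_trans ltr01 _; near: n; exact: near_ln_ge.
have mge := measurable_theta_hat_ge Y n (th + eps).
have mle := measurable_theta_hat_le Y n (th - eps).
have P0 : 0 < Pr Q [set w | theta_hat Y n w <= th - eps] by near: n.
have kP : - k <= ln (Pr Q [set w | theta_hat Y n w <= th - eps]) / ln n%:R.
  near: n; apply: cvgr_ge lo_l _ _; rewrite /k; lra.
have upP : Pr Q [set w | th + eps <= theta_hat Y n w] <=
    Pr Q [set w | theta_hat Y n w <= th - eps].
  apply: le_trans (_ : expR (- (k * ln n%:R)) <= _); first by near: n.
  rewrite -[leRHS]lnK ?posrE// ler_expR -mulNr -ler_pdivlMr//.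
rewrite (_ : [set w | eps <= `|theta_hat Y n w - th|] =
    [set w | theta_hat Y n w <= th - eps] `|` [set w | th + eps <= theta_hat Y n w]); last first.
  apply/seteqP; split => w /=; rewrite ler_normr.
    by move=> /orP[]?; [right|left]; lra.
  by move=> [?|?]; apply/orP; [right|left]; lra.
have loP : Pr Q [set w | theta_hat Y n w <= th - eps] <=
   Pr Q ([set w | theta_hat Y n w <= th - eps] `|` [set w | th + eps <= theta_hat Y n w]).
  by apply: le_Pr => //; exact: measurableU.
have upU : Pr Q ([set w | theta_hat Y n w <= th - eps] `|`
    [set w | th + eps <= theta_hat Y n w]) <=
    2 * Pr Q [set w | theta_hat Y n w <= th - eps].
  apply: le_trans (_ : Pr Q [set w | theta_hat Y n w <= th - eps] +
    Pr Q [set w | th + eps <= theta_hat Y n w] <= _); last lra.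
  rewrite /Pr -fineD ?fin_num_measure// fine_le ?fin_num_measure ?fin_numD//.
  - exact: measurableU.
  - by rewrite !fin_num_measure.
  - exact: measureU2.
have U0 := lt_le_trans P0 loP.
have ln2 : 0 <= ln 2 :> R by rewrite ln_ge0// ler1n.
move: loP; rewrite -ler_ln ?posrE// => loP.
move: upU; rewrite -ler_ln ?posrE ?mulr_gt0// lnM ?posrE// => upU.
by rewrite ler_norml; lra.
Unshelve. all: by end_near. Qed.

End large_deviations.

Lemma cvgr_mul_pinfty (R : realType) (a : R) : 0 < a ->
  a * x @[x --> (+oo : set_system R)] --> (+oo : set_system R).
Proof.
move=> a0; apply/cvgryPge => b; near=> x.
rewrite mulrC -ler_pdivrMr//; near: x; apply: nbhs_pinfty_ge; exact: num_real.
Unshelve. all: by end_near. Qed.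

(** * Slow variation of g = ln o h o exp *)

Section doubling.
Context (R : realType) (g : R -> R) (g_nd : {homo g : x y / x <= y})
  (g2 : g (2 * t) - g t @[t --> +oo] --> 0).

Lemma doubling_exp (k : nat) : g (2 ^+ k * t) - g t @[t --> +oo] --> 0.
Proof.
elim: k => [|k IH].
  under eq_fun do rewrite expr0 mul1r subrr; exact: cvg_cst.
have := cvg_comp _ _ (@cvgr_mul_pinfty R 2 (ltr0Sn R 1)) IH; rewrite /comp/= => h.
have {}h : g (2 ^+ k * (2 * t)) - g (2 * t) + (g (2 * t) - g t) @[t --> +oo] --> 0.
  by rewrite -[X in _ --> X]addr0; exact: cvgD h g2.
by apply: cvg_trans h; apply: near_eq_cvg; apply: nearW => t; rewrite exprSr -mulrA subrKA.
Qed.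

(** Eventually b lies in [l/2, 2l], so t/b lies between 2^-k t and 2^k t for a fixed k, and
    monotonicity squeezes g(t/b). *)
Lemma doubling_cvg_ratio (I : Type) (F : set_system I) (FF : ProperFilter F)
  (t b : I -> R) (l : R) : 0 < l -> t i @[i --> F] --> +oo -> b i @[i --> F] --> l ->
  g (t i / b i) - g (t i) @[i --> F] --> 0.
Proof.
move=> l0 ty bl.
have [k hk] : exists k : nat, Num.max (2 * l) (2 / l) <= 2 ^+ k.
  exists (Num.truncn (Num.max (2 * l) (2 / l))).+1.
  apply: le_trans (ltW (truncnS_gt _)) _.
  by rewrite -natrX ler_nat ltnW// ltn_expl.
move: hk; rewrite ge_max => /andP[hk1 hk2].
have k0 : 0 < 2 ^+ k :> R by rewrite exprn_gt0.
have up := cvg_comp _ _ ty (doubling_exp k).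
have down : g (t i) - g (2 ^- k * t i) @[i --> F] --> 0.
  have ty' : 2 ^- k * t i @[i --> F] --> +oo.
    by apply: cvg_comp ty (cvgr_mul_pinfty _); rewrite invr_gt0.
  have := cvg_comp _ _ ty' (doubling_exp k); rewrite /comp/=.
  by under eq_fun do rewrite mulrA divff ?gt_eqF// mul1r.
apply/cvgrPdist_le => e e0; near=> i.
have t0 : 0 < t i by near: i; move/cvgryPgt : ty; exact.
have b0 : 0 < b i by near: i; exact: (cvgr_gt _ bl).
have bu : b i <= 2 * l.
  by near: i; apply: (cvgr_le _ bl); rewrite ltr_pMl// ltr1n.
have bd : l / 2 <= b i.
  by near: i; apply: (cvgr_ge _ bl); rewrite ltr_pdivrMr// ltr_pMr// ltr1n.
have h1 : g (t i / b i) <= g (2 ^+ k * t i).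
  apply: g_nd; rewrite mulrC ler_wpM2r ?(ltW t0)//; apply: le_trans hk2.
  by rewrite -[leRHS]invrK lef_pV2 ?posrE ?invr_gt0 ?divr_gt0// invf_div.
have h2 : g (2 ^- k * t i) <= g (t i / b i).
  apply: g_nd; rewrite [leRHS]mulrC ler_wpM2r ?(ltW t0)// lef_pV2 ?posrE//.
  exact: le_trans hk1.
have h3 : `|0 - (g (2 ^+ k * t i) - g (t i))| <= e.
  by near: i; move/cvgrPdist_le : up; exact.
have h4 : `|0 - (g (t i) - g (2 ^- k * t i))| <= e.
  by near: i; move/cvgrPdist_le : down; exact.
move: h3 h4; rewrite !ler_norml => /andP[? ?] /andP[? ?].
apply/andP; split; lra.
Unshelve. all: by end_near. Qed.

(** Far out each doubling raises g by at most 1, and about log2 t doublings lead from t0 to t; from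
    below g is bounded by g(t0). *)
Lemma doubling_ln_bound : exists a b, 0 <= a /\ 0 <= b /\
  \forall t \near +oo, `|g t| <= a + b * ln t.
Proof.
move/cvgrPdist_le : g2 => /(_ 1 ltr01)[t1 [_ ht1]].
set t0 := Num.max 1 t1 + 1.
have t01 : 1 <= t0 by rewrite /t0 ler_wpDr// le_max lexx.
have g2t t : t0 <= t -> g (2 * t) <= g t + 1.
  move=> tt; have : `|0 - (g (2 * t) - g t)| <= 1.
    apply: ht1; apply: lt_le_trans tt; rewrite /t0 ltr_pwDr//.
    by rewrite le_max lexx orbT.
  by rewrite ler_norml => /andP[]; lra.
have ln2 : 0 < ln 2 :> R by rewrite ln_gt0// ltr1n.
have lnt_ge0 t : t0 <= t -> 0 <= ln t / ln 2.
  move=> tt; apply: divr_ge0; last exact: ltW.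
  by apply: ln_ge0; exact: le_trans tt.
(* k only drives the induction by halving t; the bound itself does not involve it. *)
have H (k : nat) t : t0 <= t -> t <= 2 ^+ k * t0 -> g t <= g (2 * t0) + ln t / ln 2.
  elim: k t => [|k IH] t tt.
    rewrite expr0 mul1r => tt'; apply: (@le_trans _ _ (g (2 * t0))).
      by apply: g_nd; lra.
    by rewrite lerDl lnt_ge0.
  move=> tk; have [t2|/ltW t2] := leP t (2 * t0).
    apply: (@le_trans _ _ (g (2 * t0))); first exact: g_nd.
    by rewrite lerDl lnt_ge0.
  have h2 : t0 <= t / 2 by lra.
  have hk : t / 2 <= 2 ^+ k * t0 by move: tk; rewrite exprS; lra.
  have := IH _ h2 hk; have := g2t _ h2.
  rewrite (mulrC 2) divfK// ln_div ?posrE//; last by lra.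
  by rewrite mulrBl divff ?gt_eqF//; lra.
exists (`|g (2 * t0)| + `|g t0|), (ln 2)^-1; split; first by rewrite addr_ge0.
split; first by rewrite invr_ge0 ltW.
near=> t.
have tt : t0 <= t by near: t; apply: nbhs_pinfty_ge; exact: num_real.
have gt : g t <= g (2 * t0) + ln t / ln 2.
  apply: (H (Num.truncn (t / t0)).+1) => //.
  rewrite -ler_pdivrMr ?(lt_le_trans ltr01)//.
  apply: le_trans (ltW (truncnS_gt _)) _.
  by rewrite -natrX ler_nat ltnW// ltn_expl.
have gt' : g t0 <= g t by exact: g_nd.
have lnt : 0 <= (ln 2)^-1 * ln t by rewrite mulrC lnt_ge0.
have := ler_norm (g (2 * t0)); have := ler_norm (- g t0); rewrite normrN => n1 n2.
have := normr_ge0 (g (2 * t0)); have := normr_ge0 (g t0) => n3 n4.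
rewrite ler_norml; apply/andP; split; lra.
Unshelve. all: by end_near. Qed.

End doubling.

(** A fourth root leaves room for squaring: (ln t)^2 is then still O(t^(1/2)). *)
Lemma ln_le_quartic_root (R : realType) (t : R) : 0 < t -> ln t <= 4 * t `^ 4^-1.
Proof.
move=> t0; have -> : ln t = 4 * ln (t `^ 4^-1) by rewrite ln_powR mulrA divff// mul1r.
by rewrite ler_pM2l//; apply/ltW/ln_sublinear; rewrite powR_gt0.
Qed.

Lemma cvg_ln_bounded_over_id (R : realType) (I : Type) (F : set_system I)
  (FF : ProperFilter F) (t u : I -> R) (a b : R) : 0 <= a -> 0 <= b ->
  t i @[i --> F] --> +oo -> (\forall i \near F, `|u i| <= a + b * ln (t i)) ->
  u i / t i @[i --> F] --> 0 /\ u i ^+ 2 / t i @[i --> F] --> 0.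
Proof.
move=> a0 b0 ty hu.
set c := a + 4 * b + 1.
have c0 : 0 < c by rewrite /c; lra.
(* With s = t^(1/4) one has |u| <= c s, so u / t and u^2 / t are O(s^-2). *)
have key : \forall i \near F, exists s, [/\ 1 <= s, t i = s ^+ 4 & `|u i| <= c * s].
  near=> i.
  have t1 : 1 <= t i by near: i; move/cvgryPge : ty; exact.
  have ti0 : 0 < t i := lt_le_trans ltr01 t1.
  have s1 : 1 <= t i `^ 4^-1 by rewrite -[leLHS](powRr0 (t i)) ler_powR// invr_ge0.
  exists (t i `^ 4^-1); split => //.
    by rewrite -powR_mulrn ?powR_ge0// -powRrM mulVf// powRr1// ltW.
  apply: (@le_trans _ _ (a + b * ln (t i))); first by near: i.
  have := ler_wpM2l b0 (ln_le_quartic_root ti0).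
  have : a * 1 <= a * t i `^ 4^-1 by rewrite ler_wpM2l.
  rewrite /c; lra.
have large (e : R) : 0 < e -> \forall i \near F, 1 <= e * t i.
  move=> e0; near=> i; rewrite mulrC -ler_pdivrMr//.
  by near: i; move/cvgryPge : ty; exact.
split; apply/cvgrPdist_le => e e0; near=> i.
- have [s [s1 ts us]] : exists s, [/\ 1 <= s, t i = s ^+ 4 & `|u i| <= c * s] by near: i.
  have s0 : 0 < s := lt_le_trans ltr01 s1.
  have : 1 <= (e / c) ^+ 2 * t i by near: i; apply: large; rewrite exprn_gt0// divr_gt0.
  rewrite ts (_ : (e / c) ^+ 2 * s ^+ 4 = (e / c * s ^+ 2) ^+ 2); last by ring.
  rewrite expr_ge1//; last by apply/ltW; rewrite mulr_gt0 ?divr_gt0 ?exprn_gt0.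
  move=> h; rewrite sub0r normrN normrM normfV (gtr0_norm (exprn_gt0 4 s0)).
  rewrite ler_pdivrMr ?exprn_gt0//; apply: le_trans us _.
  have : 1 <= e / c * s ^+ 3.
    apply: le_trans h _; rewrite ler_wpM2l ?divr_ge0 ?(ltW c0) ?(ltW e0)//.
    by rewrite [leRHS]exprS ler_peMl// exprn_ge0// ltW.
  rewrite mulrAC ler_pdivlMr// mul1r => /(ler_wpM2r (ltW s0)).
  by rewrite -mulrA -exprSr.
- have [s [s1 ts us]] : exists s, [/\ 1 <= s, t i = s ^+ 4 & `|u i| <= c * s] by near: i.
  have s0 : 0 < s := lt_le_trans ltr01 s1.
  have : 1 <= (e / c ^+ 2) ^+ 2 * t i.
    by near: i; apply: large; rewrite exprn_gt0// divr_gt0// exprn_gt0.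
  rewrite ts (_ : (e / c ^+ 2) ^+ 2 * s ^+ 4 = (e / c ^+ 2 * s ^+ 2) ^+ 2); last by ring.
  rewrite expr_ge1//; last by apply/ltW; rewrite mulr_gt0 ?divr_gt0 ?exprn_gt0.
  rewrite mulrAC ler_pdivlMr ?exprn_gt0// mul1r => h.
  rewrite sub0r normrN normrM normfV normrX (gtr0_norm (exprn_gt0 4 s0)).
  rewrite ler_pdivrMr ?exprn_gt0//.
  have : `|u i| ^+ 2 <= (c * s) ^+ 2.
    by apply: lerXn2r => //; rewrite ?nnegrE ?mulr_ge0 ?(ltW c0) ?(ltW s0).
  move=> /le_trans; apply; rewrite exprMn.
  apply: le_trans (ler_wpM2r (exprn_ge0 2 (ltW s0)) h) _.
  by rewrite -mulrA -exprD.
Unshelve. all: by end_near. Qed.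

(** Squeeze of (1 - q)^n between exp(- n q / (1 - q)) and exp(- n q); the lower bound comes from
    exp(q / (1 - q)) >= 1 + q / (1 - q) = 1 / (1 - q). *)
Lemma cvg_expr_poisson (R : realType) (q : nat -> R) (l : R) :
  (forall n, 0 <= q n <= 1) -> q n @[n --> \oo] --> 0 ->
  n%:R * q n @[n --> \oo] --> l ->
  (1 - q n) ^+ n @[n --> \oo] --> expR (- l).
Proof.
move=> q01 q0 ql.
have expc (v : nat -> R) (m : R) : v n @[n --> \oo] --> m ->
    expR (- v n) @[n --> \oo] --> expR (- m).
  move=> vm; apply: (cvg_comp (fun n => - v n) expR (cvgN vm)).
  exact: continuous_expR.
have up := expc _ _ ql.
have lo : expR (- (n%:R * q n / (1 - q n))) @[n --> \oo] --> expR (- l).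
  apply: expc; rewrite -[X in _ --> X]divr1; apply: cvgM => //.
  apply: cvgV; first exact: oner_neq0.
  by rewrite -[X in _ --> X]subr0; apply: cvgB => //; exact: cvg_cst.
apply: (@squeeze_cvgr _ _ _ _ _ _ _ _ _ lo up); near=> n.
have /andP[qn0 qn1] := q01 n.
apply/andP; split; last exact: expr_le_expR.
have q1 : q n < 1 by near: n; apply: (cvgr_lt _ q0); exact: ltr01.
have q1' : 0 < 1 - q n by rewrite subr_gt0.
rewrite -mulrA -mulrN mulrC expRM_natr; apply: lerXn2r; rewrite ?nnegrE ?expR_ge0 ?(ltW q1')//.
rewrite expRN -[leRHS]invrK lef_pV2 ?posrE ?expR_gt0 ?invr_gt0//.
apply: le_trans (expR_ge1Dx _).
by rewrite le_eqVlt; apply/orP; left; apply/eqP; field; rewrite gt_eqF.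
Unshelve. all: by end_near. Qed.

(** Squaring x doubles t = ln x, so the doubling lemmas apply to g = ln o h o exp, or to -g when h
    is nonincreasing. *)
Lemma ln_comp_expR_slowly_varying (R : realType) (h : R -> R) :
  (forall x, 0 <= x -> 0 < h x) ->
  ((forall x y, 0 <= x -> x <= y -> h x <= h y) \/
   (forall x y, 0 <= x -> x <= y -> h y <= h x)) ->
  h (x ^+ 2) / h x @[x --> +oo] --> (1 : R) ->
  (forall (t b : nat -> R) (l : R), 0 < l ->
     t n @[n --> \oo] --> +oo -> b n @[n --> \oo] --> l ->
     ln (h (expR (t n / b n))) - ln (h (expR (t n))) @[n --> \oo] --> 0) /\
  exists a b : R, 0 <= a /\ 0 <= b /\
    \forall t \near +oo, `|ln (h (expR t))| <= a + b * ln t.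
Proof.
move=> h0 hmono h2; pose g (t : R) := ln (h (expR t)).
have hE t : 0 < h (expR t) by rewrite h0// expR_ge0.
have g2 : g (2 * t) - g t @[t --> +oo] --> 0.
  have := cvg_comp _ _ (@cvg_expR_pinfty R) h2; rewrite /comp/= => h2'.
  have : ln (h (expR t ^+ 2) / h (expR t)) @[t --> +oo] --> ln (1 : R).
    by apply: (cvg_comp _ (@ln R) h2'); exact: continuous_ln.
  rewrite ln1; apply: cvg_trans; apply: near_eq_cvg; apply: nearW => t.
  by rewrite /g expRM_natl ln_div ?posrE// -expRM_natl.
case: hmono => hmono.
- have g_nd : {homo g : x y / x <= y}.
    by move=> x y xy; rewrite ler_ln ?posrE// hmono ?expR_ge0// ler_expR.
  split; last exact: doubling_ln_bound g_nd g2.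
  move=> t b l l0 ty bl; exact: (doubling_cvg_ratio g_nd g2 _ l0 ty bl).
- have g_nd : {homo (fun t => - g t) : x y / x <= y}.
    by move=> x y xy; rewrite lerN2 ler_ln ?posrE// hmono ?expR_ge0// ler_expR.
  have g2' : - g (2 * t) - (- g t) @[t --> +oo] --> 0.
    rewrite -[X in _ --> X]oppr0; under eq_fun do rewrite -opprD.
    exact: cvgN.
  split.
    move=> t b l l0 ty bl.
    have cr : - g (t n / b n) - - g (t n) @[n --> \oo] --> 0.
      exact: (doubling_cvg_ratio g_nd g2' _ l0 ty bl).
    have : - (- g (t n / b n) - - g (t n)) @[n --> \oo] --> 0.
      by rewrite -[X in _ --> X]oppr0; exact: cvgN cr.
    apply: cvg_trans; apply: near_eq_cvg; apply: nearW => n /=.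
    by rewrite opprB opprK addrC.
  have [a [b [a0 [b0 hab]]]] := doubling_ln_bound g_nd g2'.
  by exists a, b; split => //; split => //; apply: filterS hab => t; rewrite normrN.
Qed.

(** * Limit distribution *)

Section limit_distribution.
Context (R : realType)
    (d : measure_display) (T : measurableType d) (P : probability T R)
    (d' : measure_display) (T' : measurableType d') (Q : probability T' R)
    (X : {RV P >-> R}) (Y : nat -> {RV Q >-> R}) (iidY : iid_copies X Y)
    (th tau : R) (h : R -> R) (th0 : 0 < th) (h0 : forall x, 0 <= x -> 0 < h x)
    (hmono : (forall x y, 0 <= x -> x <= y -> h x <= h y) \/
      (forall x y, 0 <= x -> x <= y -> h y <= h x))
    (h2 : h (x ^+ 2) / h x @[x --> +oo] --> (1 : R))
    (tailE : asym_equiv (tail X) (fun x => log x `^ tau * h x / x `^ th)).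

(** The solution s of s / th + tau ln(ln n / th) + ln h(n) = x, the first-order form of n P(|X| >
    n^(1/a)) = e^x with a = th + s / ln n. *)
Definition gumbel_shift (x : R) (n : nat) : R :=
  - (th * tau * ln (ln n%:R)) - th * ln (h n%:R) + th * tau * ln th + th * x.

Lemma gumbel_shift_small (x : R) :
  gumbel_shift x n / ln n%:R @[n --> \oo] --> 0 /\
  gumbel_shift x n ^+ 2 / ln n%:R @[n --> \oo] --> 0.
Proof.
have [_ [a [b [a0 [b0 hab]]]]] := ln_comp_expR_slowly_varying h0 hmono h2.
set c := `|th * tau * ln th + th * x|.
apply: (@cvg_ln_bounded_over_id _ _ _ _ _ _ (c + th * a) (`|th * tau| + th * b)).
- by rewrite addr_ge0 ?normr_ge0 ?mulr_ge0 ?(ltW th0)//.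
- by rewrite addr_ge0 ?normr_ge0 ?mulr_ge0 ?(ltW th0)//.
- exact: cvg_ln_nat_pinfty.
- near=> n.
  have ln1 : 1 <= ln (n%:R : R) by near: n; exact: near_ln_ge.
  have n0 : 0 < n%:R :> R by rewrite ltNge; apply/negP => /ln0 hh; rewrite hh ler10 in ln1.
  have lnln0 : 0 <= ln (ln (n%:R : R)) by exact: ln_ge0.
  have : `|ln (h (expR (ln n%:R)))| <= a + b * ln (ln n%:R).
    by near: n; exact: (@cvg_ln_nat_pinfty R _ hab).
  rewrite lnK ?posrE// => hb.
  rewrite /gumbel_shift -addrA.
  apply: le_trans (ler_normD _ _) _.
  apply: le_trans (lerD (ler_normB _ _) (lexx _)) _; rewrite -/c.
  have -> : `|- (th * tau * ln (ln n%:R))| = `|th * tau| * ln (ln n%:R).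
    by rewrite normrN normrM (ger0_norm lnln0).
  have -> : `|th * ln (h n%:R)| = th * `|ln (h n%:R)| by rewrite normrM gtr0_norm.
  by have := ler_wpM2l (ltW th0) hb; lra.
Unshelve. all: by end_near. Qed.

(** The strict inequality comes first because its probability is given by [tail X], the function
    whose asymptotics are assumed. *)
Lemma Pr_theta_hat_lt_gumbel (x : R) :
  Pr Q [set w | theta_hat Y n w < th + gumbel_shift x n / ln n%:R]
    @[n --> \oo] --> 1 - expR (- expR x).
Proof.
have [hratio _] := ln_comp_expR_slowly_varying h0 hmono h2.
have [N1 N2] := gumbel_shift_small x.
pose a n := th + gumbel_shift x n / ln n%:R.
have a_th : a n @[n --> \oo] --> th.
  by rewrite -[X in _ --> X]addr0; apply: cvgD => //; exact: cvg_cst.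
have lnny := @cvg_ln_nat_pinfty R.
have yoo : expR (ln n%:R / a n) @[n --> \oo] --> +oo.
  apply: cvg_comp (@cvg_expR_pinfty R).
  apply/cvgryPge => b; near=> n.
  have a0 : 0 < a n by near: n; exact: (cvgr_gt _ a_th).
  have a2 : a n <= 2 * th by near: n; apply: (cvgr_le _ a_th); rewrite ltr_pMl// ltr1n.
  rewrite ler_pdivlMr//.
  have : Num.max 0 b * (2 * th) <= ln n%:R by near: n; exact: near_ln_ge.
  apply: le_trans; apply: (@le_trans _ _ (Num.max 0 b * a n)).
    by rewrite ler_wpM2r ?(ltW a0)// le_max lexx orbT.
  by rewrite ler_wpM2l// le_max lexx.
pose q n := tail X (expR (ln n%:R / a n)).
have q01 n : 0 <= q n <= 1 by exact: tail_itv.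
have q0 : q n @[n --> \oo] --> 0 := cvg_comp _ _ yoo (@cvg_tail0 _ _ _ _ X).
have nq : n%:R * q n @[n --> \oo] --> expR x.
  have ratio := cvg_comp _ _ yoo tailE; rewrite /comp/= in ratio.
  have near0 : \forall n \near \oo, [/\ 0 < (n%:R : R), 0 < ln (n%:R : R), 0 < a n
      & 1 <= ln (n%:R : R) / a n].
    near=> n.
    have ln1 : 1 <= ln (n%:R : R) by near: n; exact: near_ln_ge.
    have a0 : 0 < a n by near: n; exact: (cvgr_gt _ a_th).
    have a2 : a n <= 2 * th by near: n; apply: (cvgr_le _ a_th); rewrite ltr_pMl// ltr1n.
    have thn : 2 * th <= ln (n%:R : R) by near: n; exact: near_ln_ge.
    split => //.
    - by rewrite ltNge; apply/negP => /ln0 hh; rewrite hh ler10 in ln1.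
    - exact: lt_le_trans ln1.
    - by rewrite ler_pdivlMr// mul1r (le_trans a2).
  (* E n collects the deviation of ln (n P(|X| > y n)) from x, up to the
     factor coming from [tailE]. *)
  pose E n := tau * (ln th - ln (a n)) +
    (ln (h (expR (ln n%:R / a n))) - ln (h (expR (ln n%:R)))) -
    gumbel_shift x n ^+ 2 / ln n%:R / (th * a n).
  have E0 : E n @[n --> \oo] --> 0.
    rewrite (_ : 0 = tau * (ln th - ln th) + 0 - 0 / (th * th)); last first.
      by rewrite subrr mulr0 mul0r subr0 addr0.
    apply: cvgB; first apply: cvgD.
    - apply: cvgM; first exact: cvg_cst.
      apply: cvgB; first exact: cvg_cst.
      by apply: (cvg_comp _ (@ln R) a_th); exact: continuous_ln.
    - exact: hratio a_th.
    - apply: cvgM => //; apply: cvgV; first by rewrite mulf_neq0// gt_eqF.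
      by apply: cvgM => //; exact: cvg_cst.
  have eE : expR (x + E n) @[n --> \oo] --> expR x.
    have xE : x + E n @[n --> \oo] --> x.
      by rewrite -[X in _ --> X]addr0; apply: cvgD => //; exact: cvg_cst.
    by apply: (cvg_comp _ (@expR R) xE); exact: continuous_expR.
  pose y n := expR (ln n%:R / a n).
  have : tail X (y n) / (log (y n) `^ tau * h (y n) / y n `^ th) * expR (x + E n)
      @[n --> \oo] --> expR x.
    by rewrite -[X in _ --> X]mul1r; exact: cvgM ratio eE.
  apply: cvg_trans; apply: near_eq_cvg.
  apply: filterS near0 => n [n0 lnn0 an0 la1].
  have lny : ln (y n) = ln n%:R / a n by rewrite /y expRK.
  have logy : log (y n) = ln n%:R / a n by rewrite logE lny.
  have la0 : 0 < ln n%:R / a n := lt_le_trans ltr01 la1.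
  have hy : 0 < h (y n) by rewrite h0// expR_ge0.
  have den : log (y n) `^ tau * h (y n) / y n `^ th =
      expR (tau * ln (ln n%:R / a n) + ln (h (y n)) - th * (ln n%:R / a n)).
    rewrite logy /powR !gt_eqF ?expR_gt0// lny 2!expRD expRN lnK ?posrE//.
  (* An exact identity: the assumed form of the tail at [y n] equals exp(x + E n) / n, so n q n is
     the ratio from [tailE] times exp(x + E n). *)
  have nE : expR (x + E n) * (n%:R)^-1 =
      expR (tau * ln (ln n%:R / a n) + ln (h (y n)) - th * (ln n%:R / a n)).
    rewrite -[X in _ * X^-1 = _](@lnK _ n%:R) ?posrE// -expRN -expRD; congr expR.
    rewrite ln_div ?posrE// /E /y lnK ?posrE//.
    have aE : gumbel_shift x n = (a n - th) * ln n%:R.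
      by rewrite /a addrAC subrr add0r divfK// gt_eqF.
    have thx : th * x = (a n - th) * ln n%:R + th * tau * ln (ln n%:R) +
        th * ln (h n%:R) - th * tau * ln th.
      by rewrite -aE /gumbel_shift; ring.
    have xE : x = ((a n - th) * ln n%:R) / th + tau * ln (ln n%:R) +
        ln (h n%:R) - tau * ln th.
      by rewrite -[LHS](mulKf (lt0r_neq0 th0)) thx; field; exact: lt0r_neq0.
    rewrite {1}xE aE; field.
    by rewrite !gt_eqF.
  rewrite den -nE -[tail X (y n)]/(q n).
  by field; rewrite !gt_eqF ?expR_gt0.
have : 1 - (1 - q n) ^+ n @[n --> \oo] --> 1 - expR (- expR x).
  by apply: cvgB; [exact: cvg_cst|exact: cvg_expr_poisson q01 q0 nq].
apply: cvg_trans; apply: near_eq_cvg; near=> n.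
have ln1 : 1 <= ln (n%:R : R) by near: n; exact: near_ln_ge.
have a0 : 0 < a n by near: n; exact: (cvgr_gt _ a_th).
have a2 : a n <= 2 * th by near: n; apply: (cvgr_le _ a_th); rewrite ltr_pMl// ltr1n.
have thn : 2 * th <= ln (n%:R : R) by near: n; exact: near_ln_ge.
by rewrite -/(a n) (Pr_theta_hat_lt iidY)// a0 (le_trans a2).
Unshelve. all: by end_near. Qed.

(* The strict and the weak inequality differ by an arbitrarily small shift of x,
   and the limit is continuous in x. *)
Lemma Pr_theta_hat_le_gumbel (x : R) :
  Pr Q [set w | theta_hat Y n w - th <= gumbel_shift x n / ln n%:R]
    @[n --> \oo] --> 1 - expR (- expR x).
Proof.
apply/cvgrPdist_le => e e0.
have e20 : 0 < e / 2 by rewrite divr_gt0.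
have [e' e'0 he'] : exists2 e', 0 < e' &
    `|(1 - expR (- expR x)) - (1 - expR (- expR (x + e')))| <= e / 2.
  have c : 1 - expR (- expR (t : R)) @[t --> x] --> 1 - expR (- expR x).
    apply: cvgB; first exact: cvg_cst.
    apply: (cvg_comp (fun t => - expR t) (@expR R)); last exact: continuous_expR.
    by apply: cvgN; exact: continuous_expR.
  move/cvgrPdist_le : c => /(_ _ e20)[r /= r0 hr].
  exists (r / 2); first by rewrite divr_gt0.
  apply: hr; rewrite /= opprD addrA subrr add0r normrN gtr0_norm ?divr_gt0//.
  by rewrite ltr_pdivrMr// ltr_pMr// ltr1n.
have up := @Pr_theta_hat_lt_gumbel (x + e').
have lo := @Pr_theta_hat_lt_gumbel x.
near=> n.
have ln0 : 0 < ln (n%:R : R) by apply: lt_le_trans ltr01 _; near: n; exact: near_ln_ge.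
have hup : `|(1 - expR (- expR (x + e'))) - Pr Q [set w | theta_hat Y n w <
    th + gumbel_shift (x + e') n / ln n%:R]| <= e / 2.
  by near: n; move/cvgrPdist_le : up; exact.
have hlo : `|(1 - expR (- expR x)) - Pr Q [set w | theta_hat Y n w <
    th + gumbel_shift x n / ln n%:R]| <= e / 2.
  by near: n; move/cvgrPdist_le : lo; exact.
rewrite (_ : [set w | _ <= _] =
    [set w | theta_hat Y n w <= th + gumbel_shift x n / ln n%:R]); last first.
  by apply/funext => w /=; rewrite lerBlDl.
have le1 : Pr Q [set w | theta_hat Y n w < th + gumbel_shift x n / ln n%:R] <=
    Pr Q [set w | theta_hat Y n w <= th + gumbel_shift x n / ln n%:R].
  apply: le_Pr; [exact: measurable_theta_hat_lt|exact: measurable_theta_hat_le|].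
  by move=> w /= /ltW.
have le2 : Pr Q [set w | theta_hat Y n w <= th + gumbel_shift x n / ln n%:R] <=
    Pr Q [set w | theta_hat Y n w < th + gumbel_shift (x + e') n / ln n%:R].
  apply: le_Pr; [exact: measurable_theta_hat_le|exact: measurable_theta_hat_lt|].
  move=> w /= /le_lt_trans; apply; rewrite ltrD2l ltr_pM2r ?invr_gt0//.
  by rewrite /gumbel_shift ltrD2l ltr_pM2l// ltrDl.
move: hup hlo he'; rewrite !ler_norml => /andP[? ?] /andP[? ?] /andP[? ?].
apply/andP; split; lra.
Unshelve. all: by end_near. Qed.

End limit_distribution.
Unset Implicit Arguments.

Theorem theorem2p6 (R : realType)
    (d : measure_display) (T : measurableType d) (P : probability T R)
    (d' : measure_display) (T' : measurableType d') (Q : probability T' R)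
    (X : {RV P >-> R}) (Y : nat -> {RV Q >-> R})
    (iidY : iid_copies X Y) :
  (* (i) *)
  ({ae Q, forall w,
      limn_einf (fun n => (theta_hat Y n w)%:E) = theta X /\
      limn_esup (fun n => (theta_hat Y n w)%:E) = theta_upper X} /\
   let a := {ae Q, forall w, (theta_hat Y n w)%:E @[n --> \oo] --> theta X} in
   let b := cvg_in_probability Q (theta_hat Y) (theta X) in
   let c := (theta X < +oo)%E -> forall r : R, (theta X < r%:E)%E ->
              x `^ r * tail X x @[x --> +oo] --> +oo in
   [/\ a <-> b, b <-> c
     & forall th : R, theta X = th%:E ->
       let l := exists L : R -> R,
         [/\ forall x, 0 < x -> 0 < L x,
             asym_equiv (tail X) (fun x => L x / x `^ th)
           & ln (L x) / ln x @[x --> +oo] --> (0 : R)] in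
       [/\ a <-> l, b <-> l & c <-> l]])
  /\
  (* (ii) *)
  (forall th : R, theta X = th%:E -> 0 < th ->
   cvg_in_probability Q (theta_hat Y) (theta X) ->
   [/\ forall s : R, 0 < s -> s < th ->
         ln (Pr Q [set w | theta_hat Y n w <= th - s]) / ln (n%:R : R)
           @[n --> \oo] --> - (s / (th - s)),
       forall t : R, 0 < t ->
         log (- ln (Pr Q [set w | theta_hat Y n w >= th + t])) / ln (n%:R : R)
           @[n --> \oo] --> t / (th + t)
     & forall eps : R, 0 < eps -> eps < th ->
         ln (Pr Q [set w | `|theta_hat Y n w - th| >= eps]) / ln (n%:R : R)
           @[n --> \oo] --> - (eps / (th - eps))])
  /\
  (* (iii) *)
  (forall (th tau : R) (h : R -> R), 0 < th ->
   (forall x, 0 <= x -> 0 < h x) ->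
   ((forall x y, 0 <= x -> x <= y -> h x <= h y) \/
    (forall x y, 0 <= x -> x <= y -> h y <= h x)) ->
   h (x ^+ 2) / h x @[x --> +oo] --> (1 : R) ->
   asym_equiv (tail X) (fun x => log x `^ tau * h x / x `^ th) ->
   forall x : R,
     Pr Q [set w | theta_hat Y n w - th <=
                   (- (th * tau * ln (ln (n%:R : R))) - th * ln (h n%:R)
                    + th * tau * ln th + th * x) / ln (n%:R : R)]
       @[n --> \oo] --> 1 - expR (- expR x)).
Proof.
have aP := theta_hat_cvg_aeP iidY; have bP := theta_hat_cvg_in_probabilityP iidY.
have cP := theta_upper_le_thetaP X.
split; last split.
- split; first exact: theta_hat_liminf_limsup.
  split; [by rewrite aP bP|by rewrite bP cP|move=> th thE].
  have lP := theta_upper_le_theta_slowly_varying thE.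
  split; [by rewrite aP lP|by rewrite bP lP|by rewrite -cP lP].
- move=> th thE th0 /bP upth; split.
  + by move=> s s0 sth; have [] := Pr_theta_hat_le_exponent iidY thE upth s0 sth.
  + by move=> t; exact: (Pr_theta_hat_ge_exponent iidY thE th0 upth).
  + by move=> eps; exact: (Pr_theta_hat_dist_exponent iidY thE th0 upth).
- move=> th tau h th0 h0 hmono h2 tailE x.
  exact: (Pr_theta_hat_le_gumbel iidY th0 h0 hmono h2 tailE).
Qed.
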